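(* Let $R=k[x_1,\ldots,x_d]$ be a polynomial ring over a field $k$, let $\mathfrak{m}=(x_1,\ldots,x_d)$, let $I\subseteq R$ be a locally normal monomial ideal, and fix an integer $i\geq 0$. Assume $\lambda(\operatorname{H}^i_{\mathfrak m}(R/I^n))<\infty$ for $n\gg 0$. Then the limit $$\lim_{n\to\infty}\frac{\lambda(\operatorname{H}^i_{\mathfrak m}(R/I^n))}{n^d}$$ exists and is a rational number.
   Context: $\lambda(-)$ denotes length and $\operatorname{H}^i_{\mathfrak m}(-)$ local cohomology. For $j\in\{1,\ldots,d\}$, $I_{\{j\}}$ denotes the monomial ideal of $R$ obtained from $I$ by setting $x_j=1$ (i.e. generated by the images of the monomials of $I$ under $x_j\mapsto 1$, $x_l\mapsto x_l$ for $l\neq j$). The monomial ideal $I$ is locally normal if $I_{\{j\}}$ is normal for every $j$, i.e. $I_{\{j\}}^n=\overline{I_{\{j\}}^n}$ for every $j$ and every $n$, where the bar denotes integral closure. *)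

(* Defs.v *)
From HB Require Import structures.
From mathcomp Require Import all_boot all_order all_algebra.
From mathcomp Require Import generic_quotient ring_quotient zify ring.
From mathcomp Require Import boolp classical_sets reals ereal.
(* The notations of mpoly are incompatible with those of mathcomp-analysis. *)
From mathcomp Require Import -(notations) mpoly.

Set Implicit Arguments.
Unset Strict Implicit.
Unset Printing Implicit Defensive.

Import Order.TTheory GRing.Theory Num.Theory.

Local Open Scope ring_scope.
Local Open Scope quotient_scope.
Local Open Scope classical_set_scope.

Section QuotientModule.
Variables (A : pzRingType) (M : lmodType A) (N : submodClosed M).

(* A copy of N carrying the [zmodClosed] structure that [Quotient.quot] needs
   and that [submodClosed] does not provide. *)
Definition submod_pred : {pred M} := N.

HB.instance Definition _ :=
  GRing.isSubmodClosed.Build A M submod_pred (GRing.subsemimodClosedP N).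

Definition quot_mod : Type := Quotient.quot submod_pred.

HB.instance Definition _ := GRing.Zmodule.on quot_mod.

Definition quot_pi (x : M) : quot_mod := \pi_(Quotient.quot submod_pred) x.

Lemma quot_piP (x y : M) : reflect (quot_pi x = quot_pi y) (x - y \in N).
Proof.
rewrite -[x - y \in N]/(x - y \in submod_pred) Quotient.idealrBE.
exact: eqP.
Qed.

Lemma quot_piD : {morph quot_pi : x y / x + y}.
Proof. by move=> x y; rewrite /quot_pi piE. Qed.

Lemma quot_piW (P : quot_mod -> Prop) : (forall x, P (quot_pi x)) -> forall u, P u.
Proof. exact: quotW. Qed.

Definition quot_scale (a : A) (u : quot_mod) : quot_mod :=
  quot_pi (a *: repr (u : Quotient.quot submod_pred)).

Lemma quot_scaleE a x : quot_scale a (quot_pi x) = quot_pi (a *: x).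
Proof.
apply/quot_piP; rewrite -scalerBr rpredZ //; apply/quot_piP.
by rewrite /quot_pi reprK.
Qed.

Lemma quot_scaleA a b u : quot_scale a (quot_scale b u) = quot_scale (a * b) u.
Proof. by elim/quot_piW: u => x; rewrite !quot_scaleE scalerA. Qed.

Lemma quot_scale1 : left_id 1 quot_scale.
Proof. by elim/quot_piW => x; rewrite quot_scaleE scale1r. Qed.

Lemma quot_scaleDr : right_distributive quot_scale +%R.
Proof.
move=> a; elim/quot_piW => x; elim/quot_piW => y.
by rewrite -quot_piD !quot_scaleE -quot_piD scalerDr.
Qed.

Lemma quot_scaleDl u : {morph quot_scale^~ u : a b / a + b}.
Proof.
by elim/quot_piW: u => x a b; rewrite !quot_scaleE -quot_piD scalerDl.
Qed.

HB.instance Definition _ := GRing.Zmodule_isLmodule.Build A quot_mod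
  quot_scaleA quot_scale1 quot_scaleDr quot_scaleDl.

End QuotientModule.

Section Length.
Variables (K : realType) (A : pzRingType) (M : lmodType A).

(* N 0 < ... < N l; the values of N beyond l are irrelevant. *)
Definition strict_chain (l : nat) (N : nat -> submodClosed M) : Prop :=
  forall j, (j < l)%N -> [set` N j] `<` [set` N j.+1].

Definition mod_length : \bar K :=
  ereal_sup [set l%:R%:E | l in [set l | exists N, strict_chain l N]].

End Length.

Section Span.
Variables (A : pzRingType) (M : lmodType A).

Definition span (X : set M) : {pred M} :=
  fun x => `[< forall N : submodClosed M, X `<=` [set` N] -> x \in N >].

Lemma span_closed (X : set M) : subsemimod_closed (span X).
Proof.
split; first split.
- by apply/asboolP => N _; exact: rpred0.
- by move=> x y /asboolP sx /asboolP sy; apply/asboolP => N XN;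
    apply: rpredD; [exact: sx|exact: sy].
- by move=> a x /asboolP sx; apply/asboolP => N XN; apply: rpredZ; exact: sx.
Qed.

HB.instance Definition _ (X : set M) :=
  GRing.isSubmodClosed.Build A M (span X) (span_closed X).

End Span.

Section Ideals.
Variable A : comNzRingType.

(* Unlike [idealr], this includes the unit ideal. *)
Definition ideal := submodClosed A^o.

Definition ideal_gen (X : set A) : ideal := span (X : set A^o).

Definition ideal_mul (I J : ideal) : ideal :=
  ideal_gen [set z | exists x y : A, [/\ x \in I, y \in J & z = x * y]].

Definition ideal_exp (I : ideal) (n : nat) : ideal :=
  iter n (ideal_mul I) (ideal_gen [set 1]).

Definition integral_closure (I : ideal) : {pred A} := fun r =>
  `[< exists n (a : nat -> A), [/\ (0 < n)%N,
        forall j, (0 < j <= n)%N -> a j \in ideal_exp I j &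
        r ^+ n + \sum_(1 <= j < n.+1) a j * r ^+ (n - j) = 0] >].

Definition normal_ideal (I : ideal) : Prop :=
  forall n, ideal_exp I n =i integral_closure (ideal_exp I n).

Definition ring_mod_ideal (I : ideal) : lmodType A := quot_mod I.

End Ideals.

Section Localization.
Variables (A : comPzRingType) (f : A) (M : lmodType A).

(* (m, a) stands for the fraction m / f ^+ a. *)
Definition frac_eq (u v : M * nat) : bool :=
  `[< exists c, f ^+ (c + v.2) *: u.1 = f ^+ (c + u.2) *: v.1 >].

Lemma frac_eqP u v :
  reflect (exists c, f ^+ (c + v.2) *: u.1 = f ^+ (c + u.2) *: v.1)
          (frac_eq u v).
Proof. exact: asboolP. Qed.

Lemma frac_eq_equiv : equiv_class_of frac_eq.
Proof.
have sym u v : frac_eq u v -> frac_eq v u.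
  by case/frac_eqP => c e; apply/frac_eqP; exists c.
split => [u|u v|v u w].
- by apply/frac_eqP; exists 0%N.
- by apply/idP/idP; exact: sym.
case: u v w => [m a] [n b] [p e] /frac_eqP[/= c h] /frac_eqP[/= c' h'].
apply/frac_eqP; exists (c + c' + b)%N => /=.
have -> : (c + c' + b + e = (c' + e) + (c + b))%N by lia.
rewrite exprD -scalerA h scalerA mulrC -scalerA h' scalerA -exprD.
by congr (f ^+ _ *: _); lia.
Qed.

Canonical frac_eq_equivRel := EquivRelPack frac_eq_equiv.
Canonical frac_eq_encModRel := defaultEncModRel frac_eq.

Definition localization : Type := {eq_quot frac_eq}.

HB.instance Definition _ := Choice.on localization.

Definition frac (m : M) (a : nat) : localization := \pi_({eq_quot frac_eq}) (m, a).

Definition frac_repr (u : localization) : M * nat := repr (u : {eq_quot frac_eq}).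

Lemma eq_fracP m a n b :
  (frac m a = frac n b) <-> exists c, f ^+ (c + b) *: m = f ^+ (c + a) *: n.
Proof.
split=> [/eqmodP/frac_eqP //|h].
by apply/eqmodP/frac_eqP.
Qed.

Lemma fracW (P : localization -> Prop) : (forall m a, P (frac m a)) -> forall u, P u.
Proof. by move=> Pf; elim/quotW => -[m a]; exact: Pf. Qed.

Lemma frac_reprK u : frac (frac_repr u).1 (frac_repr u).2 = u.
Proof. by rewrite /frac -surjective_pairing /frac_repr reprK. Qed.

Lemma frac_repr_frac m a : exists c,
  f ^+ (c + a) *: (frac_repr (frac m a)).1 =
  f ^+ (c + (frac_repr (frac m a)).2) *: m.
Proof. by apply/eq_fracP; rewrite frac_reprK. Qed.

Definition loc_zero := frac 0 0.

Definition loc_opp (u : localization) :=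
  let: (m, a) := frac_repr u in frac (- m) a.

Definition loc_add (u v : localization) :=
  let: (m, a) := frac_repr u in let: (n, b) := frac_repr v in
  frac (f ^+ b *: m + f ^+ a *: n) (a + b).

Definition loc_scale (r : A) (u : localization) :=
  let: (m, a) := frac_repr u in frac (r *: m) a.

Lemma loc_oppE m a : loc_opp (frac m a) = frac (- m) a.
Proof.
rewrite /loc_opp; have [c] := frac_repr_frac m a.
case: (frac_repr _) => n b /= h; apply/eq_fracP; exists c.
by rewrite !scalerN h.
Qed.

Lemma loc_scaleE r m a : loc_scale r (frac m a) = frac (r *: m) a.
Proof.
rewrite /loc_scale; have [c] := frac_repr_frac m a.
case: (frac_repr _) => n b /= h; apply/eq_fracP; exists c.
by rewrite scalerA mulrC -scalerA h !scalerA mulrC.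
Qed.

Lemma loc_addE m a n b :
  loc_add (frac m a) (frac n b) = frac (f ^+ b *: m + f ^+ a *: n) (a + b).
Proof.
rewrite /loc_add; have [c] := frac_repr_frac m a; have [e] := frac_repr_frac n b.
case: (frac_repr (frac m a)) => m' a'; case: (frac_repr (frac n b)) => n' b' /=.
move=> hn hm; apply/eq_fracP; exists (c + e)%N.
rewrite !scalerDr !scalerA -!exprD; congr (_ + _).
  have -> : (c + e + (a + b) + b' = (e + b + b') + (c + a))%N by lia.
  rewrite exprD -scalerA hm scalerA -exprD.
  by congr (f ^+ _ *: _); lia.
have -> : (c + e + (a + b) + a' = (c + a + a') + (e + b))%N by lia.
rewrite exprD -scalerA hn scalerA -exprD.
by congr (f ^+ _ *: _); lia.
Qed.

Lemma loc_addA : associative loc_add.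
Proof.
elim/fracW=> m a; elim/fracW=> n b; elim/fracW=> p e.
rewrite !loc_addE; apply/eq_fracP; exists 0%N.
rewrite !scalerDr !scalerA -!exprD addrA addnA.
by congr (_ *: _ + _ *: _ + _ *: _); congr (f ^+ _); lia.
Qed.

Lemma loc_addC : commutative loc_add.
Proof.
by elim/fracW=> m a; elim/fracW=> n b; rewrite !loc_addE addrC addnC.
Qed.

Lemma loc_add0 : left_id loc_zero loc_add.
Proof.
by elim/fracW=> m a; rewrite loc_addE scaler0 add0r add0n expr0 scale1r.
Qed.

Lemma loc_addN : left_inverse loc_zero loc_opp loc_add.
Proof.
elim/fracW=> m a; rewrite loc_oppE loc_addE; apply/eq_fracP; exists 0%N.
by rewrite scalerN addNr !scaler0.
Qed.

HB.instance Definition _ :=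
  GRing.isZmodule.Build localization loc_addA loc_addC loc_add0 loc_addN.

Lemma fracD m a n b :
  frac m a + frac n b = frac (f ^+ b *: m + f ^+ a *: n) (a + b).
Proof. exact: loc_addE. Qed.

Lemma loc_scaleA r s u : loc_scale r (loc_scale s u) = loc_scale (r * s) u.
Proof. by elim/fracW: u => m a; rewrite !loc_scaleE scalerA. Qed.

Lemma loc_scale1 : left_id 1 loc_scale.
Proof. by elim/fracW=> m a; rewrite loc_scaleE scale1r. Qed.

Lemma loc_scaleDr : right_distributive loc_scale +%R.
Proof.
move=> r; elim/fracW=> m a; elim/fracW=> n b.
rewrite fracD !loc_scaleE fracD scalerDr !scalerA.
by rewrite mulrC [r * f ^+ a]mulrC.
Qed.

Lemma loc_scaleDl u : {morph loc_scale^~ u : r s / r + s}.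
Proof.
elim/fracW: u => m a r s; rewrite !loc_scaleE fracD; apply/eq_fracP; exists 0%N.
rewrite !add0n -scalerDr -scalerDl !scalerA.
by congr (_ *: _); rewrite exprD; ring.
Qed.

HB.instance Definition _ := GRing.Zmodule_isLmodule.Build A localization
  loc_scaleA loc_scale1 loc_scaleDr loc_scaleDl.

Lemma fracZ r m a : r *: frac m a = frac (r *: m) a.
Proof. exact: loc_scaleE. Qed.

End Localization.

(* The natural map M_f -> M_(h f), m / f ^+ a |-> (h ^+ a *: m) / (h f) ^+ a;
   the target is written M_g to allow for different forms of h * f. *)
Definition loc_map (A : comPzRingType) (M : lmodType A) (f g h : A)
    (u : localization f M) : localization g M :=
  let: (m, a) := frac_repr u in frac g (h ^+ a *: m) a.

Lemma loc_mapE (A : comPzRingType) (M : lmodType A) (f g h : A) (m : M) a :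
  g = h * f -> loc_map g h (frac f m a) = frac g (h ^+ a *: m) a.
Proof.
move=> ->; rewrite /loc_map; have [c] := frac_repr_frac f m a.
case: (frac_repr _) => n b /= e; apply/eq_fracP; exists c.
rewrite !scalerA !exprMn.
have -> : h ^+ (c + a) * f ^+ (c + a) * h ^+ b
        = h ^+ (c + a + b) * f ^+ (c + a) by rewrite (exprD h (c + a)); ring.
rewrite -scalerA e scalerA; congr (_ *: _).
by rewrite addnAC exprD; ring.
Qed.

Lemma loc_map_linear (A : comPzRingType) (M : lmodType A) (f g h : A) :
  g = h * f -> linear (@loc_map A M f g h).
Proof.
move=> gE r; elim/fracW=> m a; elim/fracW=> n b.
rewrite fracZ fracD !loc_mapE // fracZ fracD; apply/eq_fracP; exists 0%N.
rewrite !scalerDr !scalerA; congr (_ *: _ + _ *: _);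
  by rewrite gE !exprMn !exprD; ring.
Qed.

Section DepFunModule.
Variables (A : pzRingType) (I : finType) (V : I -> lmodType A).

Definition dep_prod : Type := {dffun forall i, V i}.

HB.instance Definition _ := Choice.copy dep_prod {dffun forall i, V i}.

Local Notation VI := dep_prod.
Implicit Types u v w : VI.

Definition dffun_zero : VI := [ffun i => 0].
Definition dffun_opp u : VI := [ffun i => - u i].
Definition dffun_add u v : VI := [ffun i => u i + v i].
Definition dffun_scale (r : A) u : VI := [ffun i => r *: u i].

Lemma dffun_addA : associative dffun_add.
Proof. by move=> u v w; apply/ffunP => i; rewrite !ffunE addrA. Qed.

Lemma dffun_addC : commutative dffun_add.
Proof. by move=> u v; apply/ffunP => i; rewrite !ffunE addrC. Qed.

Lemma dffun_add0 : left_id dffun_zero dffun_add.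
Proof. by move=> u; apply/ffunP => i; rewrite !ffunE add0r. Qed.

Lemma dffun_addN : left_inverse dffun_zero dffun_opp dffun_add.
Proof. by move=> u; apply/ffunP => i; rewrite !ffunE addNr. Qed.

HB.instance Definition _ :=
  GRing.isZmodule.Build dep_prod dffun_addA dffun_addC dffun_add0 dffun_addN.

Lemma dffun_scaleA r s u : dffun_scale r (dffun_scale s u) = dffun_scale (r * s) u.
Proof. by apply/ffunP => i; rewrite !ffunE scalerA. Qed.

Lemma dffun_scale1 : left_id 1 dffun_scale.
Proof. by move=> u; apply/ffunP => i; rewrite !ffunE scale1r. Qed.

Lemma dffun_scaleDr : right_distributive dffun_scale +%R.
Proof. by move=> r u v; apply/ffunP => i; rewrite !ffunE scalerDr. Qed.

Lemma dffun_scaleDl u : {morph dffun_scale^~ u : r s / r + s}.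
Proof. by move=> r s; apply/ffunP => i; rewrite !ffunE scalerDl. Qed.

HB.instance Definition _ := GRing.Zmodule_isLmodule.Build A dep_prod
  dffun_scaleA dffun_scale1 dffun_scaleDr dffun_scaleDl.

Lemma dep_prodDE (u v : dep_prod) i : (u + v) i = u i + v i.
Proof. by rewrite ffunE. Qed.

Lemma dep_prodZE r (u : dep_prod) i : (r *: u) i = r *: u i.
Proof. by rewrite ffunE. Qed.

End DepFunModule.

Section Cech.
Variables (A : comNzRingType) (d : nat) (x : 'I_d -> A) (M : lmodType A).

Definition xprod (S : {set 'I_d}) : A := \prod_(j in S) x j.

Definition subset_of_size (p : nat) : finType := {S : {set 'I_d} | #|S| == p}.

(* The Cech complex C^p = \bigoplus_(#|S| = p) M_(x_S). *)
Definition cech (p : nat) : lmodType A :=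
  dep_prod (fun S : subset_of_size p => localization (xprod (val S)) M).

(* For T = S U {j}: the number of elements of T preceding j. *)
Definition cech_sign (S T : {set 'I_d}) : nat :=
  #|[set l in T | [exists j in T :\: S, (l < j)%N]]|.

Definition cech_d (p : nat) (c : cech p) : cech p.+1 :=
  [ffun T : subset_of_size p.+1 =>
    \sum_(S : subset_of_size p | val S \subset val T)
      (-1) ^+ cech_sign (val S) (val T) *:
        loc_map (xprod (val T)) (xprod (val T :\: val S)) (c S)].

Lemma xprodU (S T : {set 'I_d}) :
  S \subset T -> xprod T = xprod (T :\: S) * xprod S.
Proof.
move=> ST; rewrite /xprod [LHS](big_setID S) /= mulrC.
by rewrite (finset.setIidPr ST).
Qed.

Lemma cech_d_linear p : linear (@cech_d p).
Proof.
move=> r u v; apply/ffunP => T.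
rewrite dep_prodDE dep_prodZE !ffunE scaler_sumr -big_split /=.
apply: eq_bigr => S ST.
rewrite dep_prodDE dep_prodZE (loc_map_linear (xprodU ST)).
by rewrite scalerDr !scalerA mulrC.
Qed.

HB.instance Definition _ p := GRing.isLinear.Build A (cech p) (cech p.+1)
  *:%R (@cech_d p) (@cech_d_linear p).

Definition cocycle (p : nat) : {pred cech p} := fun c => cech_d c == 0.

Arguments cocycle : clear implicits.

Lemma cocycle_closed p : subsemimod_closed (cocycle p).
Proof.
split; first split.
- by rewrite /cocycle unfold_in raddf0.
- move=> u v; rewrite /cocycle !unfold_in => /eqP u0 /eqP v0.
  by rewrite raddfD /= u0 v0 addr0.
- move=> r u; rewrite /cocycle !unfold_in => /eqP u0.
  by rewrite linearZ /= u0 scaler0.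
Qed.

HB.instance Definition _ p :=
  GRing.isSubmodClosed.Build A (cech p) (cocycle p) (cocycle_closed p).

Definition cocycles (p : nat) : Type := {c : cech p | c \in cocycle p}.

HB.instance Definition _ p := SubChoice.on (cocycles p).
HB.instance Definition _ p := [SubChoice_isSubLmodule of cocycles p by <:].

(* C^(-1) = 0. *)
Definition coboundary (p : nat) : {pred cocycles p} :=
  if p is q.+1 return {pred cocycles p}
  then fun z => `[< exists b : cech q, \val z = cech_d b >]
  else fun z => z == 0.

Arguments coboundary : clear implicits.

Lemma coboundary_closed p : subsemimod_closed (coboundary p).
Proof.
case: p => [|q].
  split; first split; rewrite /coboundary ?unfold_in //.
  - by move=> u v; rewrite !unfold_in => /eqP-> /eqP->; rewrite addr0.
  - by move=> r u; rewrite !unfold_in => /eqP->; rewrite scaler0.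
split; first split.
- by apply/asboolP; exists 0; rewrite !raddf0.
- move=> u v /asboolP[b ub] /asboolP[b' vb]; apply/asboolP; exists (b + b').
  by rewrite !raddfD /= ub vb.
- move=> r u /asboolP[b ub]; apply/asboolP; exists (r *: b).
  by rewrite !linearZ /= ub.
Qed.

HB.instance Definition _ p :=
  GRing.isSubmodClosed.Build A (cocycles p) (coboundary p) (coboundary_closed p).

(* The i-th local cohomology of M with support in the ideal generated by x. *)
Definition local_cohomology (i : nat) : lmodType A := quot_mod (coboundary i).

End Cech.

Section MonomialIdeals.
Variables (k : fieldType) (d : nat).
Local Notation R := (mpoly d k).
Local Notation monom := (@mpolyX d k).

Definition var (j : 'I_d) : R := monom (mnm1 j).

Definition monomial_ideal (I : ideal R) : Prop :=
  exists X : set (multinom d), I =i ideal_gen [set monom m | m in X].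

Definition set_var_one (j : 'I_d) (f : R) : R :=
  comp_mpoly [tuple if l == j then 1 else var l | l < d] f.

Definition ideal_at_one (j : 'I_d) (I : ideal R) : ideal R :=
  ideal_gen [set set_var_one j (monom m) | m in [set m | monom m \in I]].

Definition locally_normal (I : ideal R) : Prop :=
  forall j : 'I_d, normal_ideal (ideal_at_one j I).

Definition lc_length (K : realType) (I : ideal R) (i n : nat) : \bar K :=
  mod_length K (local_cohomology var (ring_mod_ideal (ideal_exp I n)) i).

End MonomialIdeals.

(* Main.v *)
Require Import Defs.
From HB Require Import structures.
From mathcomp Require Import all_boot all_order all_algebra.
From mathcomp Require Import boolp classical_sets reals ereal.
From mathcomp Require Import topology normedtype sequences.
From mathcomp Require Import -(notations) mpoly.
From mathcomp Require Import zify ring lra.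

Import Order.TTheory GRing.Theory Num.Theory numFieldNormedType.Exports.

Set Implicit Arguments.
Unset Strict Implicit.
Unset Printing Implicit Defensive.

Local Open Scope classical_set_scope.
Local Open Scope ring_scope.

(** Fix the cohomological index and write H_n for the local cohomology of
    R/I^n, computed by the Cech complex.  The proof turns the length of H_n into
    a count of lattice points and the limit into a Riemann sum.

    Degrees.  The Cech complex is graded by Z^d.  In degree a it is the cochain
    complex, over k, of the family F of the sets S for which x^a is a nonzero
    element of the localization of R/I^n at the product of the variables in S;
    its cohomology has a dimension [betti k F p] that depends on F alone.  The
    length of H_n is the sum of these dimensions over all degrees
    ([length_le_betti], [length_ge_betti]).

    Newton polyhedra.  For nonempty S, local normality says that x^a lies in
    I^n localized at S exactly when a/n lies in a rational polyhedron
    [newton v S], since denominators in a convex combination can be cleared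
    ([in_local_newtonE]).  For empty S this fails only in the exceptional
    degrees, those of the monomials in the integral closure of I^n outside I^n.
    Multiplying by a fixed power of any one variable takes the integral closure
    of I^n into I^n ([newton_absorb]), so that the exceptional degrees lie in a
    box of side O(n) and meet each axis-parallel line in O(1) points: there are
    O(n^(d-1)) of them ([exceptional_count]), too few to affect the limit.

    Bounded support.  Let g(x) be the dimension attached to the family of the
    sets S with x outside [newton v S] and x_l >= 0 for l outside S.  This family
    does not change when a coordinate of x that is negative, or larger than all
    exponents of the generators, moves further away.  If g were nonzero at such
    an x, scaling by a common denominator would give infinitely many degrees
    with nonzero cohomology, and an infinite length; hence g vanishes outside a
    bounded box ([newton_betti_support]), and the length of H_n is the sum of
    g(a/n) over the lattice points of a box of side O(n), up to O(n^(d-1)).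

    Riemann sums.  By Fourier-Motzkin elimination ([polyhedral_project]) the
    polyhedra are cut out by affine inequalities with rational coefficients, so
    g belongs to the algebra [ppoly] generated by the coordinates and the
    indicators of rational half-spaces.  Integrating a function of this algebra
    over its last variable gives a function of the same kind in one variable
    less, at a distance O(1/n) from the mean over the points t/n
    ([nform_mean]).  After d integrations a rational number remains
    ([box_sum_limit]), and it is the limit. *)

(** * Bounding lengths from below and from above *)

Section LengthBounds.
Variables (K : realType) (A : pzRingType) (M : lmodType A).

Lemma strict_chain_mem l (N : nat -> submodClosed M) :
  strict_chain l N -> forall i j : nat, (i <= j <= l)%N ->
  forall x, x \in N i -> x \in N j.
Proof.
move=> sN i; elim=> [|j IH] /andP[ij jl] x xi; first by move: ij xi; rewrite leqn0 => /eqP->.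
move: ij; rewrite leq_eqVlt => /orP[/eqP <- //|ij].
have [+ _] := sN j jl; apply => /=; apply: IH => //; lia.
Qed.

Lemma mod_length_le_nat l :
  (forall N : nat -> submodClosed M, ~ strict_chain l.+1 N) ->
  (mod_length K M <= l%:R%:E)%E.
Proof.
move=> nc; apply: ge_ereal_sup => _ [m [N sN] <-].
rewrite lee_fin ler_nat leqNgt; apply/negP => lm; apply: (nc N) => j jl.
by apply: sN; apply: leq_trans jl lm.
Qed.

Lemma mod_length_ge_nat l (N : nat -> submodClosed M) :
  strict_chain l N -> (l%:R%:E <= mod_length K M)%E.
Proof. by move=> sN; apply: ereal_sup_ubound; exists l => //; exists N. Qed.

End LengthBounds.

Section AnnihilatorOfMap.
Variables (V : zmodType) (A : pzRingType) (M : lmodType A) (z : M -> V).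
Hypothesis (z0 : z 0 = 0) (zD : {morph z : x y / x + y}).

Definition ann_pred : {pred M} := fun x => `[< forall f : A, z (f *: x) = 0 >].

Lemma ann_closed : subsemimod_closed ann_pred.
Proof.
split; first split.
- by apply/asboolP => f; rewrite scaler0.
- move=> x y /asboolP hx /asboolP hy; apply/asboolP => f.
  by rewrite scalerDr zD hx hy addr0.
- by move=> a x /asboolP hx; apply/asboolP => f; rewrite scalerA hx.
Qed.

HB.instance Definition _ := GRing.isSubmodClosed.Build A M ann_pred ann_closed.

Definition annihilator : submodClosed M := ann_pred.

End AnnihilatorOfMap.

(** The functional [z j] certifies that [w j] is not in the submodule generated
    by the earlier [w i]: all multiples of these are killed by [z j]. *)
Lemma mod_length_ge (K : realType) (A : pzRingType) (M : lmodType A)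
    (V : zmodType) (l : nat) (w : nat -> M) (z : nat -> M -> V) :
  (forall j, z j 0 = 0) -> (forall j, {morph z j : x y / x + y}) ->
  (forall i j (f : A), (i < j < l)%N -> z j (f *: w i) = 0) ->
  (forall j, (j < l)%N -> z j (w j) != 0) ->
  (l%:R%:E <= mod_length K M)%E.
Proof.
move=> z0 zD zw0 zw1.
pose N j : submodClosed M := Defs.span [set w i | i in [set i | (i < j)%N]].
apply: (@mod_length_ge_nat K A M l N) => j jl.
have wi (n i : nat) : (i < n)%N -> w i \in N n.
  by move=> ij; apply/asboolP => P wP; apply: wP => /=; exists i.
split.
  move=> x /asboolP xj; apply: xj => _ [i /= ij <-]; apply: wi; exact: ltnW.
move=> /(_ (w j) (wi _ _ (ltnSn j))) /= /asboolP /(_ (annihilator (z0 j) (zD j))).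
suff wA : [set w i | i in [set i | (i < j)%N]] `<=` [set` annihilator (z0 j) (zD j)].
  move=> /(_ wA) /asboolP /(_ 1); rewrite scale1r => zj0.
  by move: (zw1 j jl); rewrite zj0 eqxx.
move=> _ [i /= ij <-]; apply/asboolP => f; apply: zw0; by rewrite ij jl.
Qed.

(** A chain of submodules is in particular a chain of subspaces, so it is no
    longer than the dimension of any vector space into which M embeds. *)
Lemma mod_length_le (K : realType) (k : fieldType) (A : pzRingType)
    (M : lmodType A) (W : vectType k) (c : k -> A) (psi : M -> W) :
  {morph psi : x y / x + y} -> (forall a x, psi (c a *: x) = a *: psi x) ->
  (forall x, psi x = 0 -> x = 0) ->
  (mod_length K M <= (dim W)%:R%:E)%E.
Proof.
move=> psiD psiZ psiI.
have psi0 : psi 0 = 0 by apply: (addrI (psi 0)); rewrite -psiD !addr0.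
have psi_sum (I : Type) (r : seq I) P (F : I -> M) :
    psi (\sum_(i <- r | P i) F i) = \sum_(i <- r | P i) psi (F i).
  exact: (big_morph psi psiD psi0).
apply: mod_length_le_nat => N sN; set l := dim W in sN *.
have ex j : exists x, (j < l.+1)%N -> x \in N j.+1 /\ x \notin N j.
  have [jl|] := boolP (j < l.+1)%N; last by exists 0.
  have [_ /existsNP[x /not_implyP[x1 x0]]] := sN j jl.
  by exists x => _; split => //; apply/negP.
have [x xP] := choice ex.
pose X := [tuple psi (x j) | j < l.+1].
have : free X.
  apply/freeP => t; under eq_bigr do rewrite -tnth_nth tnth_mktuple -psiZ.
  rewrite -psi_sum => /psiI s0.
  (* The coefficients vanish by descending induction on the index: the x j with
     a smaller index lie in N i, which does not contain x i. *)
  suff H : forall m : nat, (m <= l.+1)%N -> forall i : 'I_l.+1, (l.+1 - m <= i)%N -> t i = 0.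
    by move=> i; apply: (H l.+1); rewrite ?subnn.
  elim=> [|m IH] ml i; first by have := ltn_ord i; lia.
  move=> im; have [/(IH (ltnW ml)) //|iE] := leqP (l.+1 - m)%N i.
  apply/eqP; apply/negPn/negP => ti0.
  have [] := xP i (ltn_ord i) => _ /negP; apply.
  have -> : x i = - (c ((t i)^-1) *: \sum_(j < l.+1 | j != i) c (t j) *: x j).
    apply/eqP; rewrite -addr_eq0; apply/eqP/psiI.
    rewrite psiD psiZ psi_sum -[psi (x i)]scale1r -(mulVf ti0) -scalerA -scalerDr.
    rewrite -psiZ -psi_sum -psiD.
    by move: s0; rewrite (bigD1 i) //= => ->; rewrite psi0 scaler0.
  rewrite -scaleN1r !rpredZ // rpred_sum // => j ji.
  have [jlt|jge] := ltnP j i.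
    rewrite rpredZ // (strict_chain_mem sN (i := j.+1)) //.
      by have := ltn_ord i; lia.
    by have [] := xP j (ltn_ord j).
  suff -> : c (t j) *: x j = 0 by exact: rpred0.
  apply: psiI; rewrite psiZ IH ?scale0r //; first exact: ltnW.
  by move: ji; rewrite -val_eqE /=; lia.
rewrite /free => /eqP fX.
have := dimvS (subvf <<X>>%VS); rewrite fX dimvf size_tuple; rewrite /l; lia.
Qed.

(** * The Cech complex in a single degree *)

Section DegreeComplex.
Variables (k : fieldType) (d : nat) (F : {set {set 'I_d}}).

(** The family F lists the S whose localization does not vanish in the given
    degree. *)
Definition cochain (p : nat) : vectType k := {ffun subset_of_size d p -> k^o}.

Definition degree_d p (v : cochain p) : cochain p.+1 :=
  [ffun T : subset_of_size d p.+1 => if val T \in F then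
     \sum_(S : subset_of_size d p | val S \subset val T)
       (-1) ^+ cech_sign (val S) (val T) * v S else 0].

Fact degree_d_linear p : linear (@degree_d p).
Proof.
move=> a u v; apply/ffunP => T; rewrite !ffunE; case: ifP => _; last first.
  by rewrite scaler0 addr0.
rewrite scaler_sumr -big_split /=; apply: eq_bigr => S _.
by rewrite !ffunE mulrDr /GRing.scale /= mulrCA.
Qed.
HB.instance Definition _ p := GRing.isLinear.Build k (cochain p) (cochain p.+1)
  *:%R (@degree_d p) (@degree_d_linear p).

Definition off_support p (v : cochain p) : cochain p :=
  [ffun S : subset_of_size d p => if val S \in F then 0 else v S].

Fact off_support_linear p : linear (@off_support p).
Proof.
move=> a u v; apply/ffunP => T; rewrite !ffunE; case: ifP => _ //.
by rewrite scaler0 addr0.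
Qed.
HB.instance Definition _ p := GRing.isLinear.Build k (cochain p) (cochain p)
  *:%R (@off_support p) (@off_support_linear p).

Definition supported p : {vspace cochain p} := lker (linfun (@off_support p)).

Lemma supportedP p (v : cochain p) :
  reflect (forall S, val S \notin F -> v S = 0) (v \in supported p).
Proof.
rewrite memv_ker lfunE /=; apply: (iffP eqP) => [h S SF|h].
  by move/ffunP/(_ S): h; rewrite !ffunE (negPf SF).
by apply/ffunP => S; rewrite !ffunE; case: ifPn => // /h.
Qed.

Definition degree_cocycles p : {vspace cochain p} :=
  (supported p :&: lker (linfun (@degree_d p)))%VS.

Lemma degree_cocyclesP p (v : cochain p) :
  reflect (v \in supported p /\ degree_d v = 0) (v \in degree_cocycles p).
Proof.
by rewrite memv_cap memv_ker lfunE /=; apply: (iffP andP) => -[-> /eqP].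
Qed.

Definition degree_coboundaries p : {vspace cochain p} :=
  if p is q.+1 return {vspace cochain p}
  then (linfun (@degree_d q) @: supported q)%VS else 0%VS.

Lemma degree_coboundariesP q (v : cochain q.+1) :
  v \in degree_coboundaries q.+1 <->
  exists2 b : cochain q, b \in supported q & v = degree_d b.
Proof.
split => [/memv_imgP[b bs ->]|[b bs ->]]; first by exists b => //; rewrite lfunE.
by rewrite /= -[degree_d b]lfunE memv_img.
Qed.

(** Representatives of the cohomology: a complement, inside the cocycles, of
    the coboundaries among them. *)
Definition degree_reps p : {vspace cochain p} :=
  (degree_cocycles p :\: degree_coboundaries p)%VS.

Definition betti p : nat := \dim (degree_reps p).

Lemma betti_le p : (betti p <= #|subset_of_size d p|)%N.
Proof.
apply: leq_trans (dimvS (subvf _)) _.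
by rewrite dimvf /dim /= muln1.
Qed.

Definition class_coord p (r : 'I_(betti p)) (v : cochain p) : k :=
  coord (vbasis (degree_reps p)) r
    (addv_pi1 (degree_cocycles p) (degree_coboundaries p) v).

Definition class_rep p (r : 'I_(betti p)) : cochain p := (vbasis (degree_reps p))`_r.

Fact class_coord_linear p r : linear_for *%R (@class_coord p r).
Proof. by move=> a u v; rewrite /class_coord !linearP. Qed.
HB.instance Definition _ p r := GRing.isLinear.Build k (cochain p) k
  *%R (@class_coord p r) (@class_coord_linear p r).

Lemma class_rep_cocycle p r : @class_rep p r \in degree_cocycles p.
Proof.
by apply: (subvP (diffvSl _ _)); apply/vbasis_mem/mem_nth; rewrite size_tuple.
Qed.

Lemma addv_pi1_id p v : v \in degree_reps p ->
  addv_pi1 (degree_cocycles p) (degree_coboundaries p) v = v.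
Proof. by move=> vr; apply: daddv_pi_id => //; rewrite capv_diff. Qed.

Lemma class_coord_rep p r s : class_coord s (@class_rep p r) = (r == s)%:R.
Proof.
rewrite /class_coord addv_pi1_id; last first.
  by apply/vbasis_mem/mem_nth; rewrite size_tuple.
by rewrite /class_rep coord_free // (basis_free (vbasisP _)).
Qed.

Lemma coboundary_of_coord0 p v : v \in degree_cocycles p ->
  (forall r, @class_coord p r v = 0) -> v \in degree_coboundaries p.
Proof.
move=> vz v0.
have /addv_pi1_pi2 <- : v \in (degree_cocycles p + degree_coboundaries p)%VS.
  by rewrite memvE (subv_trans _ (addvSl _ _)) // -memvE.
rewrite [X in X + _](_ : _ = 0) ?add0r ?memv_pi2 //.
set u := addv_pi1 _ _ _; have : u \in degree_reps p by apply: memv_pi.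
move=> /coord_vbasis ->; rewrite big1 // => r _.
by rewrite [coord _ _ _]v0 scale0r.
Qed.

Lemma class_coord_coboundary p r v : v \in degree_coboundaries p ->
  @class_coord p r v = 0.
Proof.
move=> vb; rewrite /class_coord; set u := addv_pi1 _ _ _.
suff -> : u = 0 by rewrite linear0.
apply/eqP; rewrite -memv0 -(capv_diff (degree_cocycles p) (degree_coboundaries p)).
rewrite memv_cap; apply/andP; split; first exact: memv_pi.
have /addv_pi1_pi2 : v \in (degree_cocycles p + degree_coboundaries p)%VS.
  by rewrite memvE (subv_trans _ (addvSr _ _)) // -memvE.
move/(canRL (addrK _)) => E; rewrite /u E.
by rewrite rpredB ?memv_pi2.
Qed.

End DegreeComplex.

(** * Degrees in Z^d and coefficients of polynomials *)

Section Degrees.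
Variables (k : fieldType) (d : nat).
Local Notation R := (mpoly d k).
Local Notation mX := (@mpolyX d k).
Local Notation deg := {ffun 'I_d -> int}.
Implicit Types (m : multinom d) (f g : R) (a b : deg) (S T : {set 'I_d}).

Definition mnm_of_fun (t : 'I_d -> nat) : multinom d := Multinom (mktuple t).

Lemma mnm_of_funE t j : mnm_of_fun t j = t j.
Proof. by rewrite multinomE tnth_mktuple. Qed.

Definition deg_nonneg a := [forall j, 0 <= a j].

Definition mnm_of_deg a : multinom d := mnm_of_fun (fun j => `|a j|%N).

Definition deg_of_mnm m : deg := [ffun j => (m j)%:Z].

(** The exponent of the e-th power of the product of the variables in S. *)
Definition ones S (e : nat) : deg := [ffun j => if j \in S then e%:Z else 0].

Lemma degP a b : (forall j : 'I_d, a j = b j) -> a = b.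
Proof. by move=> ab; apply/ffunP => j; exact: ab. Qed.

Lemma deg_of_mnmK m : mnm_of_deg (deg_of_mnm m) = m.
Proof. by apply/mnmP => j; rewrite mnm_of_funE ffunE. Qed.

Lemma mnm_of_degK a : deg_nonneg a -> deg_of_mnm (mnm_of_deg a) = a.
Proof.
move=> /forallP a0; apply: degP => j; rewrite ffunE mnm_of_funE.
by rewrite gez0_abs.
Qed.

Lemma deg_of_mnm_ge0 m : deg_nonneg (deg_of_mnm m).
Proof. by apply/forallP => j; rewrite ffunE. Qed.

Lemma onesD S e e' : ones S (e + e') = ones S e + ones S e'.
Proof. by apply: degP => j; rewrite !ffunE; case: ifP => _; rewrite ?PoszD. Qed.

Lemma onesDS S T e : S \subset T -> ones T e = ones S e + ones (T :\: S) e.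
Proof.
move=> /fintype.subsetP ST; apply: degP => j; rewrite !ffunE inE.
by have [/ST ->|] := boolP (j \in S); rewrite ?addr0 ?add0r.
Qed.

(** Coefficients extended by zero to exponents with a negative entry, so that
    multiplication by a monomial is a translation ([zcoefXM]). *)
Definition zcoef a f : k := if deg_nonneg a then mcoeff (mnm_of_deg a) f else 0.

Fact zcoef_linear a : linear_for *%R (zcoef a).
Proof.
move=> c f g; rewrite /zcoef; case: ifP => _; last by rewrite mulr0 addr0.
by rewrite linearP.
Qed.

HB.instance Definition _ a := GRing.isLinear.Build k R k *%R (zcoef a)
  (zcoef_linear a).

Lemma zcoefD f g a : zcoef a (f + g) = zcoef a f + zcoef a g.
Proof. exact: (raddfD (zcoef a)). Qed.
Lemma zcoefB f g a : zcoef a (f - g) = zcoef a f - zcoef a g.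
Proof. exact: (raddfB (zcoef a)). Qed.
Lemma zcoefZ c f a : zcoef a (c *: f) = c * zcoef a f.
Proof. by rewrite /zcoef; case: ifP => _; rewrite ?mcoeffZ ?mulr0. Qed.

Lemma zcoefXM m f a : zcoef a (mX m * f) = zcoef (a - deg_of_mnm m) f.
Proof.
rewrite /zcoef mulrC; have [|a'] := ifPn (deg_nonneg (a - _)).
  move=> a'; have : a = deg_of_mnm (mnm_add m (mnm_of_deg (a - deg_of_mnm m))).
    apply: degP => j; rewrite ffunE mnmDE PoszD mnm_of_funE.
    by rewrite gez0_abs ?(forallP a') // !ffunE addrC subrK.
  move: (mnm_of_deg _) => b ->.
  by rewrite deg_of_mnm_ge0 deg_of_mnmK mcoeffMX.
case: ifP => // /forallP a0; apply/eqP; rewrite mcoeff_eq0 (perm_mem (msuppMX _ _)).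
apply: contra a' => /mapP[m' _ /mnmP E]; apply/forallP => j.
move: (E j) (a0 j); rewrite mnm_of_funE mnmDE !ffunE => E0 /gez0_abs <-.
by rewrite E0 subr_ge0 lez_nat leq_addr.
Qed.

Lemma zcoefX m a : zcoef a (mX m) = (a == deg_of_mnm m)%:R.
Proof.
rewrite /zcoef; case: ifPn => [a0|]; last first.
  by case: eqP => // ->; rewrite deg_of_mnm_ge0.
rewrite mcoeffX; congr (_%:R); congr nat_of_bool.
by apply/eqP/eqP => ->; rewrite ?mnm_of_degK ?deg_of_mnmK.
Qed.

Lemma xprodX S e : xprod (var k (d:=d)) S ^+ e =
  mX (mnm_of_fun (fun j => if j \in S then e else 0%N)).
Proof.
rewrite /xprod /var mprodXE mpolyXn; congr mpolyX; apply/mnmP => j.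
rewrite mulmnE mnm_sumE mnm_of_funE.
have [jS|jS] := ifPn.
  rewrite (bigD1 j) //= mnm1E eqxx big1 ?addn0 ?mul1n // => i /andP[_].
  by rewrite mnm1E => /negPf ->.
rewrite big1 // => i iS; rewrite mnm1E; case: eqP => // ij.
by rewrite -ij iS in jS.
Qed.

Lemma zcoef_xprodM S e f a :
  zcoef a (xprod (var k (d:=d)) S ^+ e * f) = zcoef (a - ones S e) f.
Proof.
rewrite xprodX zcoefXM; congr (zcoef (a - _) f); apply: degP => j.
by rewrite !ffunE mnm_of_funE; case: ifP.
Qed.

Definition up_closed (E : set (multinom d)) := forall m m', E m -> lem m m' -> E m'.

Definition has_exponents (I : ideal R) (E : set (multinom d)) :=
  forall f, f \in I <-> forall m, m \in msupp f -> E m.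

End Degrees.

(** * Localizations of the quotient by a monomial ideal *)

Section QuotLift.
Variables (A : pzRingType) (M : lmodType A) (N : submodClosed M).

Lemma quot_pi_surj (u : quot_mod N) : exists x, quot_pi N x = u.
Proof. by elim/quot_piW: u => x; exists x. Qed.

Definition quot_lift (u : quot_mod N) : M := sval (cid (quot_pi_surj u)).

Lemma quot_liftK u : quot_pi N (quot_lift u) = u.
Proof. exact: svalP (cid (quot_pi_surj u)). Qed.

Lemma quot_lift_pi x : quot_lift (quot_pi N x) - x \in N.
Proof. by apply/quot_piP; rewrite quot_liftK. Qed.

Lemma quot_piZ c x : quot_pi N (c *: x) = c *: quot_pi N x.
Proof. by rewrite -quot_scaleE. Qed.

Lemma quot_pi0P x : (quot_pi N x = 0) <-> x \in N.
Proof.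
have -> : 0 = quot_pi N 0 by apply: (addrI (quot_pi N 0)); rewrite -quot_piD !addr0.
by split => [/quot_piP|xN]; rewrite ?subr0 //; apply/quot_piP; rewrite subr0.
Qed.
End QuotLift.

Section MonomialQuotient.
Variables (k : fieldType) (d : nat).
Local Notation R := (mpoly d k).
Local Notation mX := (@mpolyX d k).
Local Notation deg := {ffun 'I_d -> int}.
Local Notation xp := (xprod (@var k d)).
Variables (J : ideal R) (E : set (multinom d)).
Hypothesis E_up : up_closed E.
Hypothesis JE : has_exponents J E.
Implicit Types (m : multinom d) (f g : R) (a b : deg) (S T : {set 'I_d}).

Local Notation M := (ring_mod_ideal J).
Local Notation loc S := (localization (xp S) M).

Definition deg_in a := deg_nonneg a /\ E (mnm_of_deg a).

Lemma deg_in_up a b : deg_in a -> (forall j : 'I_d, a j <= b j) -> deg_in b.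
Proof.
move=> [/forallP a0 Ea] ab.
have b0 : deg_nonneg b by apply/forallP => j; apply: le_trans (a0 j) (ab j).
split => //; apply: E_up Ea _; apply/mnm_lepP => j; rewrite !mnm_of_funE.
by move: (a0 j) (ab j); case: (a j) (b j) => [x|//] [y|//].
Qed.

Lemma zcoef_ideal f a : f \in J -> ~ deg_in a -> zcoef a f = 0.
Proof.
move=> /JE fJ na; rewrite /zcoef; case: ifP => // a0.
apply/eqP; rewrite mcoeff_eq0; apply/negP => /fJ Ea; exact: na.
Qed.

(** No multiple of x^a by a power of the product of the variables in S lies in
    J: the fraction x^a is not killed when those variables are inverted. *)
Definition surviving S a : bool := `[< forall e, ~ deg_in (a + ones S e) >].

Lemma ones_ge0 S e (j : 'I_d) : 0 <= ones S e j.
Proof. by rewrite ffunE; case: ifP. Qed.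

Lemma surviving_sub S T a : S \subset T -> surviving T a -> surviving S a.
Proof.
move=> ST /asboolP sT; apply/asboolP => e Ea; apply: (sT e).
apply: deg_in_up Ea _ => j; rewrite (onesDS _ ST) [leRHS]ffunE ffunE lerD2l.
by rewrite [leRHS]ffunE lerDl ones_ge0.
Qed.

Lemma surviving_down S a b : (forall j : 'I_d, a j <= b j) ->
  surviving S b -> surviving S a.
Proof.
move=> ab /asboolP sb; apply/asboolP => e Ea; apply: (sb e).
by apply: deg_in_up Ea _ => j; rewrite ffunE [leRHS]ffunE lerD2r.
Qed.

Definition lfrac S f e : loc S := Defs.frac (xp S) (quot_pi J (f : R^o)) e.

Lemma lfracW S (P : loc S -> Prop) : (forall f e, P (lfrac S f e)) -> forall u, P u.
Proof. by move=> Pf; elim/fracW; elim/quot_piW => f e; exact: Pf. Qed.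

Lemma lfrac_eqP S f e g e' : lfrac S f e = lfrac S g e' <->
  exists c, xp S ^+ (c + e') * f - xp S ^+ (c + e) * g \in J.
Proof.
split => [/eq_fracP[c]|[c h]].
  by rewrite -!quot_piZ => /quot_piP h; exists c.
by apply/eq_fracP; exists c; rewrite -!quot_piZ; apply/quot_piP.
Qed.

Lemma lfracD S f e g e' :
  lfrac S f e + lfrac S g e' = lfrac S (xp S ^+ e' * f + xp S ^+ e * g) (e + e').
Proof. by rewrite /lfrac fracD -!quot_piZ -quot_piD. Qed.

Lemma lfracZ S f g e : g *: lfrac S f e = lfrac S (g * f) e.
Proof. by rewrite /lfrac fracZ -quot_piZ. Qed.

(** The coefficient of x^a in a fraction.  It is computed from an arbitrary
    representative; [lcoefE] shows that the choice does not matter, because the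
    coefficient of an element of J vanishes in a surviving degree. *)
Definition lcoef S a (u : loc S) : k :=
  if surviving S a
  then zcoef (a + ones S (frac_repr u).2) (quot_lift (frac_repr u).1 : R) else 0.

Lemma lcoefE S a f e : lcoef a (lfrac S f e) =
  if surviving S a then zcoef (a + ones S e) f else 0.
Proof.
rewrite /lcoef; case: ifP => // /asboolP sa.
have := frac_reprK (lfrac S f e).
case: (frac_repr _) => q e' /=; rewrite -{1}(quot_liftK q).
move: (quot_lift q) => {q} g /lfrac_eqP[c h].
apply/eqP; rewrite -subr_eq0; apply/eqP.
have := zcoef_ideal h (sa (c + e + e')%N).
have E1 : a + ones S (c + e + e') - ones S (c + e) = a + ones S e'.
  by rewrite [ones S (_ + e')]onesD addrA addrAC addrK.
have E2 : a + ones S (c + e + e') - ones S (c + e') = a + ones S e.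
  by rewrite addnAC [ones S (_ + e)]onesD addrA addrAC addrK.
by rewrite zcoefB !zcoef_xprodM E1 E2.
Qed.

Lemma lcoefD S a (u v : loc S) : lcoef a (u + v) = lcoef a u + lcoef a v.
Proof.
elim/lfracW: u => f e; elim/lfracW: v => g e'.
rewrite lfracD !lcoefE; case: ifP; rewrite ?addr0 // => _.
have E1 : a + ones S (e + e') - ones S e' = a + ones S e by rewrite onesD addrA addrK.
have E2 : a + ones S (e + e') - ones S e = a + ones S e'.
  by rewrite addnC onesD addrA addrK.
by rewrite zcoefD !zcoef_xprodM E1 E2.
Qed.

Lemma lcoef0 S a : lcoef a (0 : loc S) = 0.
Proof. by apply: (addrI (lcoef a (0 : loc S))); rewrite -lcoefD !addr0. Qed.

Lemma lcoef_sum (I : Type) (r : seq I) P S a (F : I -> loc S) :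
  lcoef a (\sum_(i <- r | P i) F i) = \sum_(i <- r | P i) lcoef a (F i).
Proof. exact: (big_morph _ (@lcoefD S a) (@lcoef0 S a)). Qed.

Lemma lcoef_XZ S a c m (u : loc S) : surviving S a ->
  lcoef a ((c *: mX m) *: u) = c * lcoef (a - deg_of_mnm m) u.
Proof.
move=> sa; elim/lfracW: u => f e; rewrite lfracZ !lcoefE sa.
rewrite (surviving_down _ sa) => [|j]; last by rewrite !ffunE gerBl.
by rewrite -scalerAl zcoefZ zcoefXM addrAC.
Qed.

Lemma lcoef_CZ S a c (u : loc S) : lcoef a (c%:A *: u) = c * lcoef a u.
Proof.
elim/lfracW: u => f e; rewrite lfracZ !lcoefE; case: ifP; rewrite ?mulr0 // => _.
by rewrite -scalerAl mul1r zcoefZ.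
Qed.

Lemma lcoef_loc_map S T a (u : loc S) : S \subset T ->
  lcoef a (loc_map (xp T) (xp (T :\: S)) u) =
  if surviving T a then lcoef a u else 0.
Proof.
move=> ST; elim/lfracW: u => f e; rewrite /lfrac (loc_mapE _ _ (xprodU _ ST)).
rewrite -quot_piZ !lcoefE; case: ifP => // /(surviving_sub ST) ->.
by rewrite zcoef_xprodM (onesDS _ ST) addrA addrK.
Qed.

(** If all coefficients of f / x_S^e vanish, then each monomial of f is carried
    into J by some power of x_S, and the largest of these powers serves for f. *)
Lemma lcoef_inj S (u : loc S) : (forall a, lcoef a u = 0) -> u = 0.
Proof.
elim/lfracW: u => f e u0.
have ex m : exists c, m \in msupp f -> deg_in (deg_of_mnm m + ones S c).
  have [mf|_] := boolP (m \in msupp f); last by exists 0%N.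
  have := u0 (deg_of_mnm m - ones S e); rewrite lcoefE subrK.
  case: ifP => [_|/asboolP/existsNP[c]].
    rewrite /zcoef deg_of_mnm_ge0 deg_of_mnmK => /eqP.
    by rewrite mcoeff_eq0 mf.
  move=> /contrapT h _; exists c => _; apply: deg_in_up h _ => j.
  by rewrite !ffunE lerD2r gerBl; case: ifP.
have [c cP] := choice ex.
have -> : 0 = lfrac S 0 0.
  by rewrite -{1}(mul0r (0 : R)) -lfracZ scale0r.
apply/lfrac_eqP; exists (\max_(m <- msupp f) c m)%N; set N := (\max_(m <- _) _)%N.
rewrite mulr0 subr0 addn0 xprodX mulrC; apply/JE => m'.
rewrite (perm_mem (msuppMX _ _)) => /mapP[m mf ->].
have [_] : deg_in (deg_of_mnm m + ones S N).
  apply: deg_in_up (cP m mf) _ => j; rewrite !ffunE lerD2l; case: ifP => // _.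
  by rewrite lez_nat; apply: leq_bigmax_seq.
congr E; apply/mnmP => j; rewrite mnm_of_funE mnmDE mnm_of_funE !ffunE.
by case: ifP => _; lia.
Qed.

Lemma lcoef_finite S (u : loc S) :
  exists s : seq deg, forall a, a \notin s -> lcoef a u = 0.
Proof.
elim/lfracW: u => f e; exists [seq deg_of_mnm m - ones S e | m <- msupp f] => a ans.
rewrite lcoefE; case: ifP => // _; rewrite /zcoef; case: ifP => // a0.
apply/eqP; rewrite mcoeff_eq0; apply: contra ans => ms; apply/mapP.
by exists (mnm_of_deg (a + ones S e)) => //; rewrite mnm_of_degK // addrK.
Qed.

(** The sets S such that the localization at S is nonzero in degree a: besides
    surviving, a can be negative only at inverted variables. *)
Definition degree_family a : {set {set 'I_d}} :=
  [set S | surviving S a && [forall l : 'I_d, (l \notin S) ==> (0 <= a l)]].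

Lemma lcoef_supp S a (u : loc S) : S \notin degree_family a -> lcoef a u = 0.
Proof.
rewrite inE negb_and; elim/lfracW: u => f e; rewrite lcoefE.
case: ifP => //= _ /forallPn[l]; rewrite negb_imply => /andP[lS al].
rewrite /zcoef; case: ifP => // /forallP/(_ l).
by rewrite !ffunE (negPf lS) addr0 (negPf al).
Qed.

(** The element c x^a; the common denominator x_S^N clears the negative entries
    of a at the indices in S. *)
Definition lmon S a (c : k) : loc S :=
  let N := (\sum_(j < d) `|a j|)%N in
  lfrac S (c *: mX (mnm_of_deg (a + ones S N))) N.

Lemma lcoef_lmon S a b c : S \in degree_family a ->
  lcoef b (lmon S a c) = if b == a then c else 0.
Proof.
rewrite inE => /andP[sa /forallP a0]; rewrite /lmon; set N := (\sum_(j < d) _)%N.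
have aN : deg_nonneg (a + ones S N).
  apply/forallP => j; rewrite !ffunE; case: ifPn => [_|jS]; last first.
    by rewrite addr0 (implyP (a0 j) jS).
  have : (`|a j| <= N)%N by rewrite /N (bigD1 j) //= leq_addr.
  move: (a j) => x; lia.
rewrite lcoefE zcoefZ zcoefX mnm_of_degK // (inj_eq (addIr _)).
case: eqP => [->|]; first by rewrite sa mulr1.
by rewrite mulr0; case: ifP.
Qed.

End MonomialQuotient.

(** * The Cech complex degree by degree *)

Section CechDegrees.
Variables (k : fieldType) (d : nat).
Local Notation R := (mpoly d k).
Local Notation mX := (@mpolyX d k).
Local Notation deg := {ffun 'I_d -> int}.
Local Notation xp := (xprod (@var k d)).
Variables (J : ideal R) (E : set (multinom d)).
Hypothesis E_up : up_closed E.
Hypothesis JE : has_exponents J E.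
Implicit Types (m : multinom d) (f g : R) (a b : deg) (S T : {set 'I_d}).

Local Notation M := (ring_mod_ideal J).
Local Notation cech p := (cech (@var k d) M p).
Local Notation F a := (degree_family E a).

Definition component p a (c : cech p) : cochain k d p :=
  [ffun S : subset_of_size d p => lcoef E a (c S)].

Lemma component_linear p a c (u v : cech p) :
  component a (c%:A *: u + v) = c *: component a u + component a v.
Proof.
apply/ffunP => S; rewrite !ffunE (lcoefD JE).
by rewrite (lcoef_CZ JE).
Qed.

Lemma componentD p a (u v : cech p) :
  component a (u + v) = component a u + component a v.
Proof. by have := component_linear a 1 u v; rewrite !scale1r. Qed.

Lemma component0 p a : component a (0 : cech p) = 0.
Proof. by apply: (addrI (component a (0 : cech p))); rewrite -componentD !addr0. Qed.

Lemma componentB p a (u v : cech p) :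
  component a (u - v) = component a u - component a v.
Proof. by apply: (addIr (component a v)); rewrite -componentD !subrK. Qed.

Lemma componentZ p a c (u : cech p) : component a (c%:A *: u) = c *: component a u.
Proof. by have := component_linear a c u 0; rewrite component0 !addr0. Qed.

Lemma component_sum p a (I : Type) (r : seq I) (P : pred I) (G : I -> cech p) :
  component a (\sum_(i <- r | P i) G i) = \sum_(i <- r | P i) component a (G i).
Proof. exact: (big_morph _ (@componentD p a) (@component0 p a)). Qed.

Lemma component_supported p a (c : cech p) : component a c \in supported k (F a) p.
Proof. by apply/supportedP => S SF; rewrite ffunE (lcoef_supp JE). Qed.

(** Where T is in the family of a, so is every S contained in T or else the
    coefficient at S vanishes; where T is not, both sides are zero. *)
Lemma component_d p a (c : cech p) :
  component a (cech_d c) = degree_d (F a) (component a c).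
Proof.
apply/ffunP => T; rewrite [RHS]ffunE; case: ifPn => [TF|TF]; last first.
  by rewrite ffunE (lcoef_supp JE).
rewrite !ffunE (lcoef_sum JE); apply: eq_bigr => S ST; rewrite !ffunE.
have -> : (-1) ^+ cech_sign (val S) (val T) =
    ((-1) ^+ cech_sign (val S) (val T))%:A :> R.
  by rewrite -[RHS]/(in_alg R _) rmorphXn rmorphN1.
rewrite (lcoef_CZ JE) (lcoef_loc_map E_up JE) //.
by move: TF; rewrite inE => /andP[-> _].
Qed.

Lemma component_inj p (c : cech p) : (forall a, component a c = 0) -> c = 0.
Proof.
move=> c0; apply/ffunP => S; rewrite [RHS]ffunE; apply: (lcoef_inj E_up JE) => a.
by move/ffunP: (c0 a) => /(_ S); rewrite !ffunE.
Qed.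

Lemma component_finite p (c : cech p) :
  exists s : seq deg, forall a, a \notin s -> component a c = 0.
Proof.
have [s sP] := choice (fun S0 : subset_of_size d p => lcoef_finite JE (c S0)).
exists (flatten [seq s X | X <- enum (subset_of_size d p)]) => a ans.
apply/ffunP => S; rewrite !ffunE sP //; apply: contra ans => aS.
by apply/flatten_mapP; exists S => //; rewrite mem_enum.
Qed.

Definition homogeneous p a (v : cochain k d p) : cech p :=
  [ffun S : subset_of_size d p => lmon J (val S) a (v S)].

Lemma component_homogeneous p a b (v : cochain k d p) :
  v \in supported k (F a) p ->
  component b (homogeneous a v) = if b == a then v else 0.
Proof.
move=> /supportedP vs; apply/ffunP => S; rewrite !ffunE.
have [SF|SF] := boolP (val S \in F a).
  by rewrite (lcoef_lmon JE) //; case: eqP => // _; rewrite ffunE.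
rewrite (_ : lmon _ _ _ _ = 0) ?(lcoef0 JE); last first.
  apply: (lcoef_inj E_up JE) => b'; rewrite /lmon vs // scale0r.
  by rewrite (lcoefE JE) raddf0; case: ifP.
by case: ifP => _; rewrite ?vs // ffunE.
Qed.

Lemma homogeneous_d p a (v : cochain k d p) : v \in degree_cocycles k (F a) p ->
  homogeneous a v \in @cocycle _ _ (@var k d) M p.
Proof.
move=> /degree_cocyclesP[vs vd]; rewrite unfold_in; apply/eqP/component_inj => b.
rewrite component_d component_homogeneous //; case: eqP => [->//|_].
by rewrite linear0.
Qed.

Local Notation Z p := (cocycles (@var k d) M p).
Local Notation B p := (@coboundary _ _ (@var k d) M p).
Local Notation H p := (local_cohomology (@var k d) M p).

Lemma component_cocycle p a (z : Z p) :
  component a (\val z) \in degree_cocycles k (F a) p.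
Proof.
apply/degree_cocyclesP; split; first exact: component_supported.
rewrite -component_d; have := valP z; rewrite /= unfold_in => /eqP ->.
exact: component0.
Qed.

Lemma component_coboundary p a (z : Z p) : z \in B p ->
  component a (\val z) \in degree_coboundaries k (F a) p.
Proof.
case: p z => [|p] z; rewrite unfold_in /=.
  by move=> /eqP ->; rewrite component0 mem0v.
move=> /asboolP[b ->]; apply/degree_coboundariesP.
by exists (component a b); rewrite ?component_d // component_supported.
Qed.

(** The degreewise primitives can be added up because a cochain has finitely
    many nonzero components. *)
Lemma coboundaryP p (z : Z p) :
  (forall a, component a (\val z) \in degree_coboundaries k (F a) p) -> z \in B p.
Proof.
case: p z => [|p] z zB; rewrite unfold_in /=.
  apply/eqP/val_inj/component_inj => a; apply/eqP.
  by have := zB a; rewrite memv0.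
have /choice[b bP] a : exists b : cochain k d p,
    b \in supported k (F a) p /\ component a (\val z) = degree_d (F a) b.
  by have [b] := (degree_coboundariesP _ _).1 (zB a); exists b.
have [s sP] := component_finite (\val z).
apply/asboolP; exists (\sum_(a <- undup s) homogeneous a (b a)).
apply/eqP; rewrite -subr_eq0; apply/eqP/component_inj => a.
rewrite componentB component_d component_sum.
under eq_bigr => a' _ do rewrite component_homogeneous ?(bP a').1 //.
rewrite -big_mkcond /=.
have [as_|as_] := boolP (a \in undup s).
  rewrite (big_rem a) //= eqxx big_seq_cond big_pred0 ?addr0.
    by rewrite (bP a).2 subrr.
  move=> a'; rewrite mem_rem_uniq ?undup_uniq // !inE.
  by rewrite (eq_sym a a'); case: eqP; rewrite ?andbF.
rewrite big_seq_cond big_pred0 => [|a']; last first.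
  by case: eqP => [<-|]; rewrite ?(negPf as_) // andbF.
by rewrite linear0 subr0 sP // -mem_undup.
Qed.

(** The family [hcoord] separates cohomology classes ([hcoord_inj]), and
    [hclass] is the dual family of homogeneous classes ([hcoord_hclass]). *)
Definition hcoord p a (r : 'I_(betti k (F a) p)) (u : H p) : k :=
  class_coord r (component a (\val (quot_lift u))).

Lemma hcoordE p a (r : 'I_(betti k (F a) p)) (z : Z p) :
  hcoord r (quot_pi (B p) z) = class_coord r (component a (\val z)).
Proof.
have /(component_coboundary a) := quot_lift_pi (B p) z.
move=> /(class_coord_coboundary r); rewrite raddfB componentB linearB /= => /eqP.
by rewrite subr_eq0 => /eqP.
Qed.

Lemma hcoordD p a (r : 'I_(betti k (F a) p)) (u v : H p) :
  hcoord r (u + v) = hcoord r u + hcoord r v.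
Proof.
elim/quot_piW: u => u; elim/quot_piW: v => v.
by rewrite -quot_piD !hcoordE raddfD componentD linearD.
Qed.

Lemma hcoord0 p a (r : 'I_(betti k (F a) p)) : hcoord r (0 : H p) = 0.
Proof. by apply: (addrI (hcoord r (0 : H p))); rewrite -hcoordD !addr0. Qed.

Lemma hcoordZ p a (r : 'I_(betti k (F a) p)) c (u : H p) :
  hcoord r (c%:A *: u) = c * hcoord r u.
Proof.
by elim/quot_piW: u => u; rewrite -quot_piZ !hcoordE linearZ componentZ linearZ.
Qed.

Lemma hcoord_inj p (u : H p) :
  (forall a (r : 'I_(betti k (F a) p)), hcoord r u = 0) -> u = 0.
Proof.
elim/quot_piW: u => z z0; apply/quot_pi0P/coboundaryP => a.
apply: coboundary_of_coord0; first exact: component_cocycle.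
by move=> r; rewrite -hcoordE.
Qed.

Definition hclass p a (r : 'I_(betti k (F a) p)) : H p :=
  quot_pi (B p) (exist (fun c => c \in @cocycle _ _ (@var k d) M p) _
    (homogeneous_d (class_rep_cocycle r))).

Lemma hcoord_hclassXM p a b (r : 'I_(betti k (F a) p)) (s : 'I_(betti k (F b) p))
    c m : b != a + deg_of_mnm m -> hcoord s ((c *: mX m) *: hclass r) = 0.
Proof.
move=> ba; rewrite /hclass -quot_piZ hcoordE linearZ /=.
rewrite [component _ _](_ : _ = 0) ?linear0 //; apply/ffunP => S; rewrite [RHS]ffunE.
have := lcoef_supp JE (S := val S) (a := b).
have [SF _|_ SF] := boolP (val S \in F b); last by rewrite ffunE SF.
move: SF; rewrite inE => /andP[sb _].
have := component_homogeneous (b - deg_of_mnm m)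
  (degree_cocyclesP _ _ (class_rep_cocycle r)).1.
rewrite subr_eq (negPf ba) => /ffunP/(_ S); rewrite !ffunE => E0.
by rewrite (lcoef_XZ E_up JE) // E0 mulr0.
Qed.

Lemma hcoord_hclass p a (r s : 'I_(betti k (F a) p)) :
  hcoord s (hclass r) = (r == s)%:R.
Proof.
rewrite /hclass hcoordE /= component_homogeneous ?eqxx ?class_coord_rep //.
by have [] := degree_cocyclesP _ _ (class_rep_cocycle r).
Qed.

End CechDegrees.

(** * The length as a sum of Betti numbers *)

Section LengthFormula.
Variables (K : realType) (k : fieldType) (d : nat).
Local Notation R := (mpoly d k).
Local Notation mX := (@mpolyX d k).
Local Notation deg := {ffun 'I_d -> int}.
Variables (J : ideal R) (E : set (multinom d)).
Hypothesis E_up : up_closed E.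
Hypothesis JE : has_exponents J E.
Variable p : nat.
Local Notation H := (local_cohomology (@var k d) (ring_mod_ideal J) p).

Definition degree_betti (a : deg) : nat := betti k (degree_family E a) p.

Lemma length_le_betti (D : finType) (a : D -> deg) :
  (forall b, degree_betti b != 0 -> exists i, a i = b) ->
  (mod_length K H <= (\sum_i degree_betti (a i))%:R%:E)%E.
Proof.
move=> aP; pose X := {i : D & 'I_(degree_betti (a i))}.
pose psi (u : H) : {ffun X -> k^o} := [ffun x => hcoord (tagged x) u].
have -> : (\sum_i degree_betti (a i))%N = dim {ffun X -> k^o}.
  rewrite /dim /= muln1 card_tagged sumnE big_map big_enum /=.
  by apply: eq_bigr => i _; rewrite card_ord.
apply: (mod_length_le K (c := fun c => c%:A) (psi := psi)).
- by move=> u v; apply/ffunP => x; rewrite !ffunE (hcoordD E_up JE).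
- by move=> c u; apply/ffunP => x; rewrite !ffunE (hcoordZ E_up JE).
move=> u u0; apply: (hcoord_inj E_up JE) => b r.
have [i ib] : exists i, a i = b.
  by apply: aP; rewrite -lt0n; apply: leq_ltn_trans (ltn_ord r).
subst b; move/ffunP: u0 => /(_ (Tagged (fun i => 'I_(degree_betti (a i))) r)).
by rewrite !ffunE.
Qed.

Definition total_degree (a : deg) : int := \sum_j a j.

Lemma total_degreeD a b : total_degree (a + b) = total_degree a + total_degree b.
Proof. by rewrite /total_degree -big_split; apply: eq_bigr => l _; rewrite ffunE. Qed.

Lemma total_degree_mnm m : total_degree (deg_of_mnm m) = (\sum_i m i)%N.
Proof.
rewrite (big_morph Posz PoszD (erefl _)); apply: eq_bigr => l _.
by rewrite ffunE.
Qed.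

(** List the basis classes by decreasing total degree.  A multiple of an earlier
    class by a monomial other than 1 has a larger total degree than a later
    class, so the coordinates dual to the later class kill it. *)
Lemma length_ge_betti (s : seq deg) : uniq s ->
  ((\sum_(a <- s) degree_betti a)%:R%:E <= mod_length K H)%E.
Proof.
move=> us; pose X := {a : deg & 'I_(degree_betti a)}.
pose L0 : seq X := [seq Tagged (fun a => 'I_(degree_betti a)) r |
                     a <- s, r <- enum 'I_(degree_betti a)].
pose le (x y : X) := total_degree (tag y) <= total_degree (tag x).
pose L := sort le L0.
have le_total : total le by move=> x y; exact: le_total.
have le_trans : transitive le by move=> x y z xy yz; exact: (le_trans yz xy).
have uL : uniq L.
  rewrite sort_uniq; apply: allpairs_uniq_dep => //= [a _|]; first exact: enum_uniq.
  by move=> [a r] [b t] _ _ /= E0.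
have -> : (\sum_(a <- s) degree_betti a)%N = size L.
  rewrite size_sort size_allpairs_dep sumnE big_map; apply: eq_bigr => a _.
  by rewrite size_enum_ord.
case: (L) uL (sort_sorted le_total L0 : sorted le L) => [|x0 L'] uL sL.
  by apply: (mod_length_ge_nat K (N := fun=> Defs.span set0)) => j.
pose x := nth x0 (x0 :: L').
apply: (mod_length_ge K (w := fun j => hclass E_up JE (tagged (x j)))
  (z := fun j u => hcoord (tagged (x j)) u : k^o)).
- by move=> j; rewrite (hcoord0 E_up JE).
- by move=> j u v; rewrite (hcoordD E_up JE).
- move=> i j f /andP[ij jl].
  rewrite [f]mpolyE scaler_suml (big_morph _ (@hcoordD _ _ _ _ E_up JE _ _ (tagged (x j)))
    (@hcoord0 _ _ _ _ E_up JE _ _ (tagged (x j)))).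
  apply: big1_seq => m _ /=.
  have [ba|ba] := eqVneq (tag (x j)) (tag (x i) + deg_of_mnm m); last first.
    by rewrite hcoord_hclassXM.
  have ji : le (x i) (x j).
    by apply: (sorted_ltn_nth le_trans x0 sL) => //; rewrite inE; apply: ltn_trans jl.
  have m0 : m = mnm0.
    apply/eqP; rewrite -mdeg_eq0 mdegE; move: ji.
    rewrite /le ba total_degreeD gerDl total_degree_mnm.
    by rewrite lez_nat leqn0.
  have xij : x i != x j by rewrite nth_uniq //= ?(ltn_trans ij) // ltn_eqF.
  move: ba xij; rewrite m0; case: (x i) => a r; case: (x j) => b t /=.
  have -> : deg_of_mnm (mnm0 : multinom d) = 0.
    by apply: degP => l; rewrite !ffunE mnm0E.
  rewrite addr0 => ba; subst b => rt; rewrite mpolyX0.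
  rewrite (hcoordZ E_up JE) hcoord_hclass.
  suff -> : (r == t) = false by rewrite mulr0.
  by apply/eqP => E0; rewrite E0 eqxx in rt.
- by move=> j jl; rewrite hcoord_hclass eqxx oner_eq0.
Qed.

End LengthFormula.

(** * Exponents of monomial ideals *)

(** Dickson's lemma, by induction on the number n of coordinates.  The elements
    selected for the first n-1 coordinates dominate everything whose last
    coordinate is at least N; each of the finitely many smaller values of the
    last coordinate is treated separately. *)
Lemma dickson (T : eqType) (f : T -> nat -> nat) n (X : set T) :
  exists s : seq T, (forall y, y \in s -> X y) /\
    forall x, X x -> exists2 y, y \in s & forall i, (i < n)%N -> (f y i <= f x i)%N.
Proof.
elim: n X => [|n IH] X.
  have [[x0 Xx0]|X0] := pselect (exists x, X x); last first.
    by exists [::]; split => // x Xx; case: X0; exists x.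
  exists [:: x0]; split => [y|x _]; first by rewrite inE => /eqP ->.
  by exists x0; rewrite ?inE.
have [s [sX sP]] := IH X.
pose N := \max_(y <- s) f y n.
have [t tP] := choice (fun c : nat => IH [set x | X x /\ f x n = c]).
exists (s ++ flatten [seq t c | c <- iota 0 N]); split => [y|x Xx].
  rewrite mem_cat => /orP[/sX //|/flatten_mapP[c _ yc]].
  by have [/(_ _ yc)[]] := tP c.
have [Nx|xN] := leqP N (f x n).
  have [y ys yx] := sP x Xx; exists y; first by rewrite mem_cat ys.
  move=> i; rewrite ltnS leq_eqVlt => /orP[/eqP ->|/yx //].
  by apply: leq_trans Nx; apply: leq_bigmax_seq.
have [tX /(_ x (conj Xx erefl)) [y yt yx]] := tP (f x n).
exists y.
  rewrite mem_cat; apply/orP; right; apply/flatten_mapP; exists (f x n) => //.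
  by rewrite mem_iota.
move=> i; rewrite ltnS leq_eqVlt => /orP[/eqP ->|/yx //].
by have [_ ->] := tX _ yt.
Qed.

Section MonomialIdealExponents.
Variables (k : fieldType) (d : nat).
Local Notation R := (mpoly d k).
Local Notation mX := (@mpolyX d k).
Implicit Types (m : multinom d) (f g : R) (E : set (multinom d)) (I J : ideal R).

Lemma mem_mX I E m : has_exponents I E -> mX m \in I <-> E m.
Proof.
move=> IE; split => [/IE|Em]; first by apply; rewrite msuppX inE.
by apply/IE => m'; rewrite msuppX inE => /eqP ->.
Qed.

(** Recognizes a monomial ideal from its generators: the polynomials with all
    exponents in E form an ideal because E is upward closed. *)
Lemma has_exponents_gen (X : set R) E : up_closed E ->
  (forall z m, X z -> m \in msupp z -> E m) ->
  (forall m, E m -> mX m \in ideal_gen X) -> has_exponents (ideal_gen X) E.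
Proof.
move=> Eup XE EX f; split => [/asboolP fX|fE]; last first.
  rewrite [f]mpolyE big_seq; apply: rpred_sum => m mf.
  by rewrite -mul_mpolyC; apply: (rpredZ (mpolyC d _ : R)); apply/EX/fE.
pose P : {pred R^o} := fun g => `[< forall m, m \in msupp (g : R) -> E m >].
have Pc : subsemimod_closed P.
  split; first split.
  - by apply/asboolP => m; rewrite msupp0.
  - move=> g h /asboolP gP /asboolP hP; apply/asboolP => m /msuppD_le.
    by rewrite mem_cat => /orP[/gP|/hP].
  - move=> g h /asboolP hP; apply/asboolP => m /msuppM_le /allpairsP[[m1 m2]].
    by move=> [/= _ /hP Em ->]; apply: Eup Em _; exact: lem_addl.
pose PM := GRing.isSubmodClosed.Build R R^o P Pc.
pose Q : submodClosed R^o := HB.pack P PM.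
have /asboolP : (f : R^o) \in Q by apply: fX => z Xz; apply/asboolP => m; exact: XE.
exact.
Qed.

Definition gens_exps r (v : 'I_r -> multinom d) : set (multinom d) :=
  [set m | exists i, lem (v i) m].

Lemma monomial_ideal_gens I : monomial_ideal I ->
  exists (r : nat) (v : 'I_r -> multinom d),
    has_exponents I (gens_exps v).
Proof.
move=> [X IX].
have [s [sX sP]] := dickson (fun (m : multinom d) i => nth 0%N m i) d X.
exists (size s), (fun i => nth (mnm0 : multinom d) s i) => f; rewrite IX.
apply: has_exponents_gen => [m m' [i im] mm'|_ m [y Xy <-]|m [i im]].
- by exists i; apply: lepm_trans im mm'.
- rewrite msuppX inE => /eqP ->.
  have [y' ys yy] := sP _ Xy; have ys' : (index y' s < size s)%N by rewrite index_mem.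
  exists (Ordinal ys') => /=; rewrite nth_index //; apply/mnm_lepP => j.
  by rewrite !(mnm_nth 0%N) yy.
- rewrite -(submK im) mpolyXD; apply: (rpredZ (mX _)).
  by apply/asboolP => N; apply => /=; exists (nth mnm0 s i) => //; apply/sX/mem_nth.
Qed.

Fixpoint pow_exps E n : set (multinom d) :=
  if n is n'.+1 then
    [set m | exists m1 m2, [/\ E m1, pow_exps E n' m2 & lem (mnm_add m1 m2) m]]
  else setT.

Lemma pow_exps_up E n : up_closed (pow_exps E n).
Proof.
case: n => [//|n] m m' [m1 [m2 [E1 E2 mm]]] mm'.
by exists m1, m2; split => //; apply: lepm_trans mm mm'.
Qed.

Lemma ideal_mul_exps I J E E' : has_exponents I E -> has_exponents J E' ->
  has_exponents (ideal_mul I J)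
    [set m | exists m1 m2, [/\ E m1, E' m2 & lem (mnm_add m1 m2) m]].
Proof.
move=> IE JE; apply: has_exponents_gen.
- move=> m m' [m1 [m2 [E1 E2 mm]]] mm'.
  by exists m1, m2; split => //; apply: lepm_trans mm mm'.
- move=> _ m [x [y [/IE xE /JE yE ->]]] /msuppM_le /allpairsP[[m1 m2]].
  by move=> [/= /xE ? /yE ? ->]; exists m1, m2; split => //; exact: lepm_refl.
move=> m [m1 [m2 [E1 E2 mm]]]; rewrite -(submK mm) mpolyXD.
apply: (rpredZ (mX _)); apply/asboolP => N; apply => /=.
exists (mX m1), (mX m2); split; last exact: mpolyXD.
  exact/(mem_mX _ IE). exact/(mem_mX _ JE).
Qed.

Lemma ideal_exp_exps I E n : has_exponents I E ->
  has_exponents (ideal_exp I n) (pow_exps E n).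
Proof.
move=> IE; elim: n => [|n IH]; last exact: ideal_mul_exps.
apply: has_exponents_gen => // m _.
rewrite -[mX m]mulr1; apply: (rpredZ (mX m)).
by apply/asboolP => N; apply.
Qed.

Lemma pow_expsD E a b m : pow_exps E (a + b) m ->
  exists m1 m2, [/\ pow_exps E a m1, pow_exps E b m2 & lem (mnm_add m1 m2) m].
Proof.
elim: a m => [|a IH] m.
  by move=> mb; exists mnm0, m; rewrite add0m; split => //; exact: lepm_refl.
rewrite addSn => -[m1 [m2 [E1 /IH[n1 [n2 [En1 En2 nn]]] mm]]].
exists (mnm_add m1 n1), n2; split => //; first by exists m1, n1; split => //; exact: lepm_refl.
apply: lepm_trans mm; rewrite -addmA; apply/mnm_lepP => j; rewrite !mnmDE.
by move/mnm_lepP: nn => /(_ j); rewrite mnmDE leq_add2l.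
Qed.

Lemma pow_expsM E n p m : pow_exps E (n * p) m -> pow_exps (pow_exps E n) p m.
Proof.
elim: p m => [//|p IH] m; rewrite mulnS => /pow_expsD[m1 [m2 [E1 E2 mm]]].
by exists m1, m2; split => //; exact: IH.
Qed.

Lemma pow_exps_sub E E' n m : (forall m, E m -> E' m) -> pow_exps E n m -> pow_exps E' n m.
Proof.
move=> EE'; elim: n m => [//|n IH] m [m1 [m2 [E1 E2 mm]]].
by exists m1, m2; split; auto.
Qed.

(** A monomial whose p-th power lies in the p-th power of I^n is integral over
    I^n: it is a root of T^p - x^(pm). *)
Lemma normal_exps I E n p m : has_exponents I E -> normal_ideal I -> (0 < p)%N ->
  pow_exps E (n * p) (mnm_muln m p) -> pow_exps E n m.
Proof.
move=> IE nI p0 /pow_expsM mp; apply/(mem_mX _ (ideal_exp_exps n IE)).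
rewrite nI; apply/asboolP; exists p.
exists (fun j => if j == p then - mX (mnm_muln m p) else 0); split => //.
  move=> j _; case: eqP => [->|_]; last exact: rpred0.
  rewrite -mulN1r; apply: (rpredZ (-1 : R)).
  exact/(mem_mX _ (ideal_exp_exps p (ideal_exp_exps n IE))).
rewrite big_nat_recr //= eqxx subnn expr0 mulr1 big_nat big1 => [|j /andP[_ jp]].
  by rewrite add0r mpolyXn subrr.
by rewrite ltn_eqF // mul0r.
Qed.

(** Exponents of the ideal obtained by setting the variable of index j to 1. *)
Definition set_one_exps (j : 'I_d) E : set (multinom d) :=
  [set m | exists t, E (mnm_add m (mnm_muln (mnm1 j) t))].

Lemma set_var_oneX j m :
  set_var_one j (mX m) = mX (mnm_of_fun (fun l => if l == j then 0%N else m l)).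
Proof.
rewrite /set_var_one comp_mpolyX.
rewrite [RHS]mpolyXE_id; apply: eq_bigr => l _.
rewrite tnth_mktuple mnm_of_funE; case: eqP => _; first by rewrite expr1n expr0.
by [].
Qed.

Lemma set_one_exps_up j E : up_closed E -> up_closed (set_one_exps j E).
Proof.
move=> Eup m m' [t Em] mm'; exists t; apply: Eup Em _; apply/mnm_lepP => l.
by rewrite !mnmDE leq_add2r; move/mnm_lepP: mm'; apply.
Qed.

Lemma ideal_at_one_exps j I E : up_closed E -> has_exponents I E ->
  has_exponents (ideal_at_one j I) (set_one_exps j E).
Proof.
move=> Eup IE; apply: has_exponents_gen; first exact: set_one_exps_up.
- move=> _ m [y /= /(mem_mX _ IE) Ey <-]; rewrite set_var_oneX msuppX inE => /eqP ->.
  exists (y j); apply: Eup Ey _; apply/mnm_lepP => l.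
  rewrite mnmDE mnm_of_funE mulmnE mnm1E eq_sym.
  by case: eqP => [->|]; lia.
move=> m [t Em].
set m' := mnm_of_fun (fun l => if l == j then 0%N else m l).
have m'm : lem m' m.
  by apply/mnm_lepP => l; rewrite mnm_of_funE; case: eqP => // _; lia.
rewrite -(submK m'm) mpolyXD; apply: (rpredZ (mX _)).
apply/asboolP => N; apply => /=.
exists (mnm_add m (mnm_muln (mnm1 j) t)); first exact/(mem_mX _ IE).
rewrite set_var_oneX; congr mpolyX; apply/mnmP => l; rewrite [LHS]mnm_of_funE [RHS]mnm_of_funE.
by case: eqP => // lj; rewrite mnmDE mulmnE mnm1E eq_sym; case: eqP => //; lia.
Qed.

Lemma pow_exps_set_one j E n m : up_closed E -> pow_exps (set_one_exps j E) n m ->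
  set_one_exps j (pow_exps E n) m.
Proof.
move=> Eup; elim: n m => [m _|n IH m]; first by exists 0%N.
move=> [m1 [m2 [[t1 E1] /IH[t2 E2] mm]]]; exists (t1 + t2)%N.
eexists; eexists; split; [exact: E1|exact: E2|apply/mnm_lepP => l].
move/mnm_lepP: mm => /(_ l); rewrite !mnmDE !mulmnE mulnDr; lia.
Qed.

End MonomialIdealExponents.

(** * Newton polyhedra *)

Section NewtonPolyhedra.
Variables (d r : nat) (v : 'I_r -> multinom d).
Local Notation deg := {ffun 'I_d -> int}.
Implicit Types (a : deg) (S : {set 'I_d}) (c : {ffun 'I_r -> nat}) (l : 'I_d).

Lemma gens_exps_up : up_closed (gens_exps v).
Proof. by move=> m m' [i im] mm'; exists i; apply: lepm_trans im mm'. Qed.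

Definition comb c l : nat := \sum_i c i * v i l.

Lemma pow_gens_expsP n m : pow_exps (gens_exps v) n m <->
  exists2 c : {ffun 'I_r -> nat}, (\sum_i c i)%N = n & forall l, (comb c l <= m l)%N.
Proof.
elim: n m => [|n IH] m; split.
- move=> _; exists [ffun=> 0%N] => [|l]; first by rewrite big1 // => i _; rewrite ffunE.
  by rewrite /comb big1 // => i _; rewrite ffunE.
- by [].
- move=> [m1 [m2 [[i im] /IH[c cn cm] /mnm_lepP mm]]].
  exists [ffun i' => (i' == i) + c i']%N => [|l].
    under eq_bigr do rewrite ffunE.
    by rewrite big_split /= -big_mkcond big_pred1_eq cn.
  apply: leq_trans (mm l); rewrite mnmDE /comb.
  under eq_bigr do rewrite ffunE mulnDl.
  rewrite big_split /= leq_add ?cm // (bigD1 i) //= eqxx mul1n big1.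
    by rewrite addn0; move/mnm_lepP: im.
  by move=> i' /negPf ->.
- move=> [c cn cm].
  have [i ci] : exists i, (0 < c i)%N.
    apply/existsP; rewrite -[X in is_true X]negbK negb_exists; apply/negP => /forallP c0.
    by move: cn; rewrite big1 // => i _; apply/eqP; move: (c0 i); rewrite -leqNgt leqn0.
  pose c' := [ffun i' => c i' - (i' == i)]%N.
  have cE l : comb c l = (v i l + comb c' l)%N.
    rewrite /comb (bigD1 i) //= [in RHS](bigD1 i) //= ffunE eqxx.
    rewrite addnA -{1}(subnKC ci) mulnDl mul1n; congr (_ + _ + _)%N.
    by apply: eq_bigr => i' /negPf; rewrite ffunE => ->; rewrite subn0.
  have vm : lem (v i) m by apply/mnm_lepP => l; move: (cm l); rewrite cE; lia.
  exists (v i), (mnm_sub m (v i)); split.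
  + by exists i; exact: lepm_refl.
  + apply/IH; exists c' => [|l]; last by rewrite mnmBE; move: (cm l); rewrite cE; lia.
    move: cn; rewrite (bigD1 i) //= => cn; rewrite (bigD1 i) //= ffunE eqxx.
    rewrite (eq_bigr c) ?(negPf _) => [|i' /negPf ii']; last by rewrite ffunE ii' subn0.
    by apply: succn_inj; rewrite -cn -addSn subn1 prednK.
  + by rewrite addmC submK // lepm_refl.
Qed.

(** x^a lies in I^n after inverting the variables of S ([in_localP]): at the
    indices in S there is no constraint on the exponents. *)
Definition in_local S n a :=
  exists2 c : {ffun 'I_r -> nat}, (\sum_i c i)%N = n & forall l, l \notin S -> (comb c l)%:Z <= a l.

Lemma in_localP S n a :
  in_local S n a <-> exists e, deg_in (pow_exps (gens_exps v) n) (a + ones S e).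
Proof.
split=> [[c cn ca]|[e [/forallP a0 /pow_gens_expsP[c cn ca]]]]; last first.
  exists c => // l lS; have := ca l; rewrite mnm_of_funE.
  by have := a0 l; rewrite !ffunE (negPf lS) addr0; case: (a l).
pose e := (\sum_l (comb c l + `|a l|))%N; exists e.
have h l : (comb c l)%:Z <= (a + ones S e) l.
  rewrite !ffunE; case: ifPn => [_|/ca]; last by rewrite addr0.
  have : (comb c l + `|a l| <= e)%N by rewrite /e (bigD1 l) //= leq_addr.
  move: (comb c l) (a l) e => x y z; lia.
have h0 : deg_nonneg (a + ones S e) by apply/forallP => l; apply: le_trans (h l).
split => //; apply/pow_gens_expsP; exists c => // l.
rewrite mnm_of_funE; move: (h l) (forallP h0 l); move: ((a + ones S e) l) => x; lia.
Qed.

Lemma survivingP S n a : surviving (pow_exps (gens_exps v) n) S a <-> ~ in_local S n a.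
Proof.
split=> [/asboolP h /in_localP[e]|h]; first exact: h.
by apply/asboolP => e he; apply/h/in_localP; exists e.
Qed.

(** The Newton polyhedron of I localized at S: the convex hull of the exponents
    of the generators, plus the nonnegative orthant, plus the coordinate
    directions of S. *)
Definition newton S (x : nat -> rat) := exists lam : 'I_r -> rat,
  [/\ forall i, 0 <= lam i, \sum_i lam i = 1 &
      forall l, l \notin S -> \sum_i lam i * (v i l)%:R <= x l].

(** The point a/n, as a sequence that is zero beyond the first d entries. *)
Definition scaled n a : nat -> rat :=
  fun i => if insub i is Some l then (a l)%:~R / n%:R else 0.

Lemma scaledE n a l : scaled n a l = (a l)%:~R / n%:R.
Proof. by rewrite /scaled valK. Qed.

Lemma combE c l : (comb c l)%:R = \sum_i (c i)%:R * (v i l)%:R :> rat.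
Proof. by rewrite natr_sum; apply: eq_bigr => i _; rewrite natrM. Qed.

Lemma in_local_newton S n a : (0 < n)%N -> in_local S n a -> newton S (scaled n a).
Proof.
move=> n0 [c cn ca]; exists (fun i => (c i)%:R / n%:R); split.
- by move=> i; rewrite divr_ge0.
- by rewrite -mulr_suml -natr_sum cn divff // pnatr_eq0 -lt0n.
move=> l lS; rewrite scaledE.
under eq_bigr do rewrite mulrAC.
rewrite -mulr_suml -combE ler_pM2r ?invr_gt0 ?ltr0n //.
by rewrite -[(comb c l)%:R]/((comb c l)%:Z%:~R) ler_int ca.
Qed.

Lemma common_denominator (lam : 'I_r -> rat) : (forall i, 0 <= lam i) ->
  exists p (q : {ffun 'I_r -> nat}), (0 < p)%N /\ forall i, lam i * p%:R = (q i)%:R.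
Proof.
move=> lam0.
pose p := (\prod_i `|denq (lam i)|)%N.
have dl i : exists q, lam i * p%:R = q%:R.
  rewrite /p (bigD1 i) //=; move: (\prod_(_ | _) _)%N => u.
  exists (`|numq (lam i)| * u)%N; rewrite !natrM mulrA; congr (_ * _).
  rewrite -{1}[lam i]divq_num_den !pmulrn !gez0_abs ?numq_ge0 //.
  by rewrite divfK // intr_eq0 denq_eq0.
have [q qP] := choice dl.
exists p, (finfun q); split => [|i]; last by rewrite ffunE.
by rewrite prodn_gt0 // => i; rewrite absz_gt0 denq_eq0.
Qed.

(** A rational convex combination becomes a sum of generators after
    multiplication by a common denominator p of its coefficients. *)
Lemma newton_in_local S n a : (0 < n)%N -> newton S (scaled n a) ->
  exists2 p, (0 < p)%N & in_local S (n * p) (a *+ p).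
Proof.
move=> n0 [lam [lam0 lam1 laml]].
have [p [q [p0 qP]]] := common_denominator lam0.
exists p => //; exists [ffun i => n * q i]%N => [|l lS].
  under eq_bigr do rewrite ffunE.
  rewrite -big_distrr /=; congr muln; apply/eqP; rewrite -(eqr_nat rat) natr_sum.
  by under eq_bigr do rewrite -qP; rewrite -mulr_suml lam1 mul1r.
rewrite -(ler_int rat) ffunMnE rmorphMn /= -mulr_natr.
have := laml l lS; rewrite scaledE ler_pdivlMr ?ltr0n // => h.
rewrite [X in X <= _](_ : _ = (\sum_i lam i * (v i l)%:R) * n%:R * p%:R).
  by rewrite ler_pM2r // ltr0n.
rewrite -[LHS]/((comb _ l)%:R) combE -mulrA mulr_suml; apply: eq_bigr => i _.
by rewrite ffunE natrM -qP; ring.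
Qed.

Definition exponent_bound : nat := \sum_i \sum_l v i l.

Lemma exponent_le_bound i l : (v i l <= exponent_bound)%N.
Proof. by rewrite /exponent_bound (bigD1 i) //= (bigD1 l) //= -addnA leq_addr. Qed.

Lemma comb_le c l : (comb c l <= (\sum_i c i) * exponent_bound)%N.
Proof.
by rewrite big_distrl /=; apply: leq_sum => i _; rewrite leq_mul2l exponent_le_bound orbT.
Qed.

Lemma weighted_exponent_le (lam : 'I_r -> rat) l :
  (forall i, 0 <= lam i) -> \sum_i lam i = 1 ->
  \sum_i lam i * (v i l)%:R <= exponent_bound%:R.
Proof.
move=> lam0 lam1; have -> : exponent_bound%:R = \sum_i lam i * exponent_bound%:R :> rat.
  by rewrite -mulr_suml lam1 mul1r.
by apply: ler_sum => i _; apply: ler_wpM2l => //; rewrite ler_nat exponent_le_bound.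
Qed.

End NewtonPolyhedra.

(** * Degrees of powers of a locally normal ideal *)

Section LocallyNormal.
Variables (k : fieldType) (d r : nat) (v : 'I_r -> multinom d).
Variable (I : ideal (mpoly d k)).
Hypothesis Iv : has_exponents I (gens_exps v).
Hypothesis Inormal : locally_normal I.
Local Notation deg := {ffun 'I_d -> int}.
Implicit Types (a b : deg) (S : {set 'I_d}) (c : {ffun 'I_r -> nat}) (l j : 'I_d).

Lemma in_local_mono S n a b : (forall l, a l <= b l) -> in_local v S n a -> in_local v S n b.
Proof.
by move=> ab [c cn ca]; exists c => // l lS; apply: le_trans (ca l lS) (ab l).
Qed.

(** Passing through the ideal with the variable of index j set to 1, which is
    normal, costs only a power of that variable, and it is inverted since j is
    in S. *)
Lemma in_local_normal S j n p a : j \in S -> (0 < p)%N ->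
  in_local v S (n * p) (a *+ p) -> in_local v S n a.
Proof.
move=> jS p0 /in_localP[e he].
have Eup := @gens_exps_up _ _ v.
have {he} [b0 Eb] : deg_in (pow_exps (gens_exps v) (n * p)) ((a + ones S e) *+ p).
  apply: (deg_in_up (@pow_exps_up _ _ _)) he _ => l.
  rewrite mulrnDl ffunE [leRHS]ffunE lerD2l ffunE ffunMnE ffunE.
  by case: ifP => _; rewrite ?mul0rn // -mulr_natr ler_peMr // ler1n.
have p0' : (0 : int) < p%:R by rewrite ltr0n.
have b1 : deg_nonneg (a + ones S e).
  apply/forallP => l; move/forallP: b0 => /(_ l).
  by rewrite ffunMnE -mulr_natr pmulr_lge0.
pose m := mnm_of_deg (a + ones S e).
have : set_one_exps j (pow_exps (gens_exps v) n) m.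
  apply: pow_exps_set_one => //.
  apply: (normal_exps (ideal_at_one_exps j Eup Iv) (Inormal j) p0).
  apply: (@pow_exps_up _ _ _ (mnm_of_deg ((a + ones S e) *+ p))); last first.
    apply/mnm_lepP => l; rewrite mulmnE !mnm_of_funE ffunMnE.
    by rewrite -mulr_natr abszM natz absz_nat.
  apply: pow_exps_sub Eb => m' Em'; exists 0%N.
  by rewrite mulm0n addm0.
move=> [t Et]; apply/in_localP; exists (e + t)%N.
have b2 : deg_nonneg (a + ones S (e + t)).
  apply/forallP => l; move/forallP: b1 => /(_ l) h; apply: le_trans h _.
  by rewrite !ffunE; case: ifP => _; rewrite // lerD2l lez_nat leq_addr.
split => //; apply: pow_exps_up Et _; apply/mnm_lepP => l.
rewrite mnmDE mulmnE mnm1E !mnm_of_funE.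
move/forallP: b1 => /(_ l); rewrite !ffunE.
have [<-|jl] := eqVneq j l.
  rewrite jS mul1n PoszD addrA => h.
  move: (a j + e%:Z) h => x; lia.
rewrite mul0n addn0; case: ifP => _ h //.
move: (a l) h => x; rewrite PoszD; lia.
Qed.

Lemma in_local_newtonE S j n a : j \in S -> (0 < n)%N ->
  in_local v S n a <-> newton v S (scaled n a).
Proof.
move=> jS n0; split; first exact: in_local_newton.
by move/(newton_in_local n0) => [p p0]; exact: (in_local_normal jS).
Qed.

(** An exponent such that any variable to this power multiplies the integral
    closure of I^n into I^n, for every n ([newton_absorb]). *)
Definition absorption : nat := r * exponent_bound v.

(** Write a as a combination of the generators with coefficients mu_i of sum n,
    plus a nonnegative vector.  The integral parts m_i split off a product of
    generators.  What remains, e, lies in n' times the Newton polyhedron for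
    n' = n - (sum of the m_i) <= r, so that local normality puts x^e in the
    power I^n' once the variable of index j is inverted.  As n' <= r, the entry
    of index j in a product of n' generators is at most [absorption]. *)
Lemma newton_absorb j n a : (0 < n)%N -> deg_nonneg a ->
  newton v finset.set0 (scaled n a) -> in_local v finset.set0 n (a + ones [set j]%SET absorption).
Proof.
move=> n0 /forallP a0 [lam [lam0 lam1 laml]].
have n0' : (0 : rat) < n%:R by rewrite ltr0n.
pose mu i := lam i * n%:R.
have mu0 i : 0 <= mu i by rewrite mulr_ge0.
have mua l : \sum_i mu i * (v i l)%:R <= (a l)%:~R.
  have := laml l; rewrite finset.inE scaledE => /(_ isT).
  rewrite ler_pdivlMr // mulr_suml; congr (_ <= _).
  by apply: eq_bigr => i _; rewrite /mu mulrAC.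
pose m : {ffun 'I_r -> nat} := [ffun i => Num.trunc (mu i)].
pose th i := mu i - (m i)%:R.
have mE i : (m i)%:R <= mu i < (m i).+1%:R by rewrite ffunE truncn_itv.
have th0 i : 0 <= th i by rewrite subr_ge0; have /andP[] := mE i.
have th1 i : th i <= 1.
  by have /andP[_ /ltW] := mE i; rewrite lerBlDr -natr1 addrC.
have smu : \sum_i mu i = n%:R by rewrite -mulr_suml lam1 mul1r.
have smn : (\sum_i m i <= n)%N.
  by rewrite -(ler_nat rat) natr_sum -smu ler_sum // => i _; have /andP[] := mE i.
pose n' := (n - \sum_i m i)%N.
have n'E : n'%:R = \sum_i th i.
  by rewrite natrB // natr_sum -smu sumrB.
have n'r : (n' <= r)%N.
  rewrite -(ler_nat rat) n'E; apply: le_trans (ler_sum _ (fun i _ => th1 i)) _.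
  by rewrite sumr_const card_ord.
pose e : deg := [ffun l => a l - (comb v m l)%:Z].
have eE l : \sum_i th i * (v i l)%:R <= (e l)%:~R.
  rewrite ffunE rmorphB /= -[(_%:Z)%:~R]/((comb v m l)%:R) combE lerBrDr -big_split /=.
  apply: le_trans (mua l); rewrite le_eqVlt; apply/orP; left; apply/eqP.
  by apply: eq_bigr => i _; rewrite -mulrDl subrK.
have e0 l : 0 <= e l.
  rewrite -(ler0z rat); apply: le_trans (eE l); apply: sumr_ge0 => i _.
  by rewrite mulr_ge0.
have [c' cn' ce'] : in_local v [set j]%SET n' e.
  have [->|n'0] := posnP n'.
    exists [ffun=> 0%N] => [|l _]; first by rewrite big1 // => i _; rewrite ffunE.
    by rewrite /comb big1 // => i _; rewrite ffunE.
  apply/(in_local_newtonE (j := j)); rewrite ?finset.inE //.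
  exists (fun i => th i / n'%:R); split.
  - by move=> i; rewrite divr_ge0.
  - by rewrite -mulr_suml -n'E divff // pnatr_eq0 -lt0n.
  move=> l _; rewrite scaledE; under eq_bigr do rewrite mulrAC.
  by rewrite -mulr_suml ler_pM2r ?eE // invr_gt0 ltr0n.
exists [ffun i => m i + c' i]%N => [|l _].
  under eq_bigr do rewrite ffunE.
  by rewrite big_split /= cn' subnKC.
have -> : comb v [ffun i => m i + c' i]%N l = (comb v m l + comb v c' l)%N.
  by rewrite /comb -big_split; apply: eq_bigr => i _; rewrite ffunE mulnDl.
have el : a l = e l + (comb v m l)%:Z by rewrite ffunE subrK.
have c'b : (comb v c' l <= absorption)%N.
  by apply: leq_trans (comb_le _ _ _) _; rewrite cn' leq_mul2r n'r orbT.
have -> : (a + ones [set j]%SET absorption) l = a l + (if l == j then absorption%:Z else 0).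
  by rewrite !ffunE finset.inE.
have := ce' l; rewrite finset.inE {}el; move: (e0 l); rewrite PoszD; clear -c'b.
move: (e l) => x x0; case: eqP => _ /=; first by lia.
by move=> /(_ isT) h; rewrite addr0 addrC lerD2r.
Qed.

(** Exponents in the integral closure of I^n but not in I^n. *)
Definition exceptional n a := [/\ deg_nonneg a, newton v finset.set0 (scaled n a) &
  ~ in_local v finset.set0 n a].

(** Were the entry of index j larger, lowering it by [absorption] would not
    leave the Newton polyhedron, and [newton_absorb] would put x^a in I^n. *)
Lemma exceptional_bound n a j : (0 < n)%N -> exceptional n a ->
  a j < (n * exponent_bound v + absorption)%:Z.
Proof.
move=> n0 [/forallP a0 na]; case: ltP => // aj; case.
have -> : a = (a - ones [set j]%SET absorption) + ones [set j]%SET absorption by rewrite subrK.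
have bE l : l != j -> (a - ones [set j]%SET absorption) l = a l.
  by move=> lj; rewrite !ffunE finset.inE (negPf lj) subr0.
have bj : (n * exponent_bound v)%:Z <= (a - ones [set j]%SET absorption) j.
  by rewrite !ffunE finset.inE eqxx lerBrDr -PoszD.
apply: newton_absorb => //.
  apply/forallP => l; have [->|/bE ->//] := eqVneq l j.
  by apply: le_trans bj.
have [lam [lam0 lam1 laml]] := na; exists lam; split => // l _.
rewrite scaledE; have [->|/bE ->] := eqVneq l j; last first.
  by rewrite -scaledE; apply: laml; rewrite finset.inE.
rewrite ler_pdivlMr ?ltr0n //; apply: (@le_trans _ _ ((n * exponent_bound v)%:Z%:~R)).
  rewrite -[leRHS]/((n * exponent_bound v)%:R) natrM mulrC ler_pM2l ?ltr0n //.
  exact: weighted_exponent_le.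
by rewrite ler_int.
Qed.

Lemma exceptional_line n a b j : (0 < n)%N -> exceptional n a -> exceptional n b ->
  (forall l, l != j -> a l = b l) -> b j < a j + absorption%:Z.
Proof.
move=> n0 [a0 na _] [_ _ nb] ab; rewrite ltNge; apply/negP => h; apply: nb.
apply: in_local_mono (newton_absorb j n0 a0 na) => l; rewrite !ffunE finset.inE.
by have [->|/ab ->] := eqVneq l j; rewrite ?addr0.
Qed.

(** The analogue of [degree_family] for the integral closures of the powers of
    I, which depends on a/n only. *)
Definition newton_family (x : nat -> rat) : {set {set 'I_d}} :=
  [set S : {set 'I_d} | ~~ `[< newton v S x >] &
    [forall l : 'I_d, (l \notin S) ==> (0 <= x l)]]%SET.

(** For nonempty S the two families agree by local normality, and for the empty
    set they disagree only in an exceptional degree. *)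
Lemma degree_familyE n a : (0 < n)%N -> ~ exceptional n a ->
  degree_family (pow_exps (gens_exps v) n) a = newton_family (scaled n a).
Proof.
move=> n0 na; apply/setP => S; rewrite !finset.inE.
have -> : [forall l : 'I_d, (l \notin S) ==> (0 <= scaled n a l)] =
          [forall l : 'I_d, (l \notin S) ==> (0 <= a l)].
  by apply/forallP/forallP => h l; move: (h l);
    rewrite scaledE pmulr_lge0 ?invr_gt0 ?ltr0n // ler0z.
have [aS|] := boolP [forall l : 'I_d, (l \notin S) ==> (0 <= a l)]; rewrite ?andbF // !andbT.
apply/idP/idP => [/survivingP nS|/asboolPn nS].
  apply/asboolPn => nw; apply: nS.
  have [S0|[j jS]] := set_0Vmem S; last exact/(in_local_newtonE a jS n0).
  apply: contrapT => h; apply: na; split; rewrite -?S0 //.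
  by apply/forallP => l; move/forallP: aS => /(_ l); rewrite S0 finset.inE.
by apply/survivingP => h; apply/nS/in_local_newton.
Qed.

End LocallyNormal.

(** * Rational polyhedra and Fourier-Motzkin elimination *)

Section Polyhedra.
Local Notation env := (nat -> rat).
Implicit Types (x y : env) (f g : env -> rat) (P : env -> Prop).

Definition upd x (m : nat) (t : rat) : env := fun i => if i == m then t else x i.

(** Points are infinite sequences, and the index m records that only the first m
    entries matter; this lets a variable be removed without changing types. *)
Definition affine m f := exists c (w : env), forall x, f x = c + \sum_(i < m) w i * x i.

Lemma affine_cst m c : affine m (fun=> c).
Proof. by exists c, (fun=> 0) => x; rewrite big1 ?addr0 // => i _; rewrite mul0r. Qed.

Lemma affine_coord m i : (i < m)%N -> affine m (fun x => x i).
Proof.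
move=> im; exists 0, (fun j => (j == i)%:R) => x; rewrite add0r (bigD1 (Ordinal im)) //=.
rewrite eqxx mul1r big1 ?addr0 // => j; rewrite -val_eqE /= => /negPf ->.
by rewrite mul0r.
Qed.

Lemma affineD m f g : affine m f -> affine m g -> affine m (fun x => f x + g x).
Proof.
move=> [c [w fE]] [c' [w' gE]]; exists (c + c'), (fun i => w i + w' i) => x.
rewrite fE gE addrACA -big_split /=; congr (_ + _); apply: eq_bigr => i _.
by rewrite mulrDl.
Qed.

Lemma affineZ m f a : affine m f -> affine m (fun x => a * f x).
Proof.
move=> [c [w fE]]; exists (a * c), (fun i => a * w i) => x.
rewrite fE mulrDr mulr_sumr; congr (_ + _); apply: eq_bigr => i _.
by rewrite mulrA.
Qed.

Lemma affineN m f : affine m f -> affine m (fun x => - f x).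
Proof.
move=> /(affineZ (-1))[c [w fE]]; exists c, w => x.
by rewrite -fE mulN1r.
Qed.

Lemma affine_sum (T : Type) (r : seq T) m (F : T -> env -> rat) :
  (forall i, affine m (F i)) -> affine m (fun x => \sum_(i <- r) F i x).
Proof.
move=> aF; elim: r => [|i r [c [w IH]]].
  by have [c [w h]] := affine_cst m 0; exists c, w => x; rewrite big_nil -h.
have [c' [w' h]] := affineD (aF i) (ex_intro _ c (ex_intro _ w IH)).
by exists c', w' => x; rewrite big_cons -h.
Qed.

Lemma affine_split m f : affine m.+1 f ->
  exists g al, affine m g /\ forall x, f x = g x + al * x m.
Proof.
move=> [c [w fE]]; exists (fun x => c + \sum_(i < m) w i * x i), (w m).
by split=> [|x]; [exists c, w | rewrite fE big_ord_recr addrA].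
Qed.

Lemma affine_dep m f x y : affine m f -> (forall i, (i < m)%N -> x i = y i) -> f x = f y.
Proof.
move=> [c [w fE]] xy; rewrite !fE; congr (_ + _); apply: eq_bigr => i _.
by rewrite xy.
Qed.

Definition polyhedral m P := exists (T : finType) (F : T -> env -> rat),
  (forall i, affine m (F i)) /\ forall x, P x <-> forall i, 0 <= F i x.

Lemma polyhedral_dep m P x y : polyhedral m P -> (forall i, (i < m)%N -> x i = y i) ->
  P x -> P y.
Proof.
move=> [T [F [aF PE]]] xy /PE h; apply/PE => i.
by rewrite -(affine_dep (aF i) xy).
Qed.

(** The inequalities with a positive slope bound t from below and those with a
    negative slope from above.  It is enough that each lower bound is at most
    each upper bound; t is then the largest lower bound, or the smallest upper
    bound if there is no lower one. *)
Lemma interval_nonempty (T : finType) (g al : T -> rat) :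
  (forall i, al i = 0 -> 0 <= g i) ->
  (forall i j, 0 < al i -> al j < 0 -> 0 <= al i * g j - al j * g i) ->
  exists t, forall i, 0 <= g i + al i * t.
Proof.
move=> h0 h.
have [[i0 i0P]|no_pos] := pselect (exists i, 0 < al i).
  case: (@Order.TotalTheory.arg_maxP _ _ _ i0 (fun i => 0 < al i) (fun i => - g i / al i) i0P).
  move=> i ai imax; exists (- g i / al i) => j.
  have [aj|aj|aj] := ltgtP (al j) 0.
  - have := h i j ai aj; rewrite -(pmulr_rge0 _ ai) => hij.
    rewrite -(pmulr_rge0 _ ai).
    have -> : al i * (g j + al j * (- g i / al i)) = al i * g j - al j * g i.
      by field; rewrite gt_eqF.
    by rewrite -(pmulr_rge0 _ ai).
  - have : - g j / al j <= - g i / al i := imax j aj; rewrite ler_pdivrMr // => hj.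
    by rewrite mulrC -[X in X + _]opprK addrC subr_ge0.
  - by rewrite aj mul0r addr0 h0.
have [[j0 j0P]|no_neg] := pselect (exists i, al i < 0).
  case: (@Order.TotalTheory.arg_minP _ _ _ j0 (fun i => al i < 0) (fun i => - g i / al i) j0P).
  move=> j aj jmin; exists (- g j / al j) => i.
  have [ai|ai|ai] := ltgtP (al i) 0.
  - have : - g j / al j <= - g i / al i := jmin i ai; rewrite ler_ndivlMr // => hj.
    by rewrite mulrC -[X in X + _]opprK addrC subr_ge0.
  - by case: no_pos; exists i.
  - by rewrite ai mul0r addr0 h0.
exists 0 => i; rewrite mulr0 addr0 h0 //; apply/eqP; case: (ltgtP (al i) 0) => // ai.
  by case: no_neg; exists i.
by case: no_pos; exists i.
Qed.

Lemma polyhedral_exists m P : polyhedral m.+1 P ->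
  polyhedral m (fun x => exists t, P (upd x m t)).
Proof.
move=> [T [F [aF PE]]].
have [g gP] := choice (fun i => affine_split (aF i)).
have [al alP] := choice gP.
pose F' (ij : T * T) x := if al ij.1 == 0 then g ij.1 x else
  if (0 < al ij.1) && (al ij.2 < 0) then al ij.1 * g ij.2 x - al ij.2 * g ij.1 x else 0.
have FE i x t : F i (upd x m t) = g i x + al i * t.
  rewrite (alP i).2 /upd eqxx; congr (_ + _); apply: (affine_dep (alP i).1) => j jm.
  by rewrite ltn_eqF.
exists (T * T)%type, F'; split => [[i j]|x].
  rewrite /F' /=; case: eqP => _; first exact: (alP i).1.
  case: (_ && _); last exact: affine_cst.
  apply: affineD; first exact: affineZ (alP j).1.
  exact: affineN (affineZ _ (alP i).1).
split=> [[t /PE ht] [i j]|h].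
  move: (ht i) (ht j); rewrite !FE /F' /=; case: eqP => [->|_]; first by rewrite mul0r addr0.
  case: ifP => // /andP[ai aj] hi hj.
  have -> : al i * g j x - al j * g i x =
    al i * (g j x + al j * t) + (- al j) * (g i x + al i * t) by ring.
  by rewrite addr_ge0 // mulr_ge0 // ?oppr_ge0 ltW.
have [||t tP] := @interval_nonempty T (fun i => g i x) al.
- by move=> i ai; have := h (i, i); rewrite /F' /= ai eqxx.
- by move=> i j ai aj; have := h (i, j); rewrite /F' /= gt_eqF // ai aj.
by exists t; apply/PE => i; rewrite FE.
Qed.

Lemma polyhedral_project m r P : polyhedral (m + r) P ->
  polyhedral m (fun x => exists2 y, (forall i, (i < m)%N -> y i = x i) & P y).
Proof.
elim: r P => [|r IH] P pP.
  rewrite addn0 in pP; have [T [F [aF PE]]] := pP; exists T, F; split => // x.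
  rewrite -PE; split => [[y yx]|Px]; last by exists x.
  exact: (polyhedral_dep pP yx).
rewrite addnS in pP; have [T [F [aF PE]]] := IH _ (polyhedral_exists pP).
exists T, F; split => // x; rewrite -PE; split.
  move=> [y yx Py]; exists y => //; exists (y (m + r)%N).
  by apply: (polyhedral_dep pP) Py => i _; rewrite /upd; case: eqP => [->|].
move=> [y yx [t Pt]]; exists (upd y (m + r) t) => // i im.
by rewrite /upd ltn_eqF ?yx // ltn_addr.
Qed.

End Polyhedra.

(** * Piecewise polynomial functions *)

Section PiecewisePolynomials.
Local Notation env := (nat -> rat).
Implicit Types (x y : env) (f g : env -> rat).

(** Functions that are polynomial with rational coefficients on the pieces of a
    subdivision by finitely many rational half-spaces. *)
Inductive ppoly m : (env -> rat) -> Prop :=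
| pp_cst c : ppoly m (fun=> c)
| pp_coord i : (i < m)%N -> ppoly m (fun x => x i)
| pp_ind f : affine m f -> ppoly m (fun x => (0 <= f x)%R%:R)
| pp_add f g : ppoly m f -> ppoly m g -> ppoly m (fun x => f x + g x)
| pp_mul f g : ppoly m f -> ppoly m g -> ppoly m (fun x => f x * g x)
| pp_ext f g : (forall x, f x = g x) -> ppoly m f -> ppoly m g.

Lemma pp_dep m f : ppoly m f ->
  forall x y, (forall i, (i < m)%N -> x i = y i) -> f x = f y.
Proof.
elim=> {f} [c|i im|f af|f g _ IHf _ IHg|f g _ IHf _ IHg|f g fg _ IH] x y xy //.
- exact: xy.
- by rewrite (affine_dep af xy).
- by rewrite (IHf x y) ?(IHg x y).
- by rewrite (IHf x y) ?(IHg x y).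
- by rewrite -!fg (IH x y).
Qed.

Lemma pp_exp m f k : ppoly m f -> ppoly m (fun x => f x ^+ k).
Proof.
move=> pf; elim: k => [|k IH]; first by apply: (@pp_ext _ (fun=> 1)) (pp_cst _ _).
by apply: (@pp_ext _ (fun x => f x * f x ^+ k)) (pp_mul pf IH) => x; rewrite exprS.
Qed.

Lemma pp_prod m (T : Type) (s : seq T) (F : T -> env -> rat) :
  (forall i, ppoly m (F i)) -> ppoly m (fun x => \prod_(i <- s) F i x).
Proof.
move=> pF; elim: s => [|i s IH].
  by apply: (@pp_ext _ (fun=> 1)) (pp_cst _ _) => x; rewrite big_nil.
apply: (@pp_ext _ (fun x => F i x * \prod_(i <- s) F i x)); last exact: pp_mul.
by move=> x; rewrite big_cons.
Qed.

Lemma pp_sum m (T : Type) (s : seq T) (F : T -> env -> rat) :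
  (forall i, ppoly m (F i)) -> ppoly m (fun x => \sum_(i <- s) F i x).
Proof.
move=> pF; elim: s => [|i s IH].
  by apply: (@pp_ext _ (fun=> 0)) (pp_cst _ _) => x; rewrite big_nil.
apply: (@pp_ext _ (fun x => F i x + \sum_(i <- s) F i x)); last exact: pp_add.
by move=> x; rewrite big_cons.
Qed.

Lemma pp_affine m f : affine m f -> ppoly m f.
Proof.
move=> [c [w fE]]; apply: (@pp_ext _ (fun x => c + \sum_(i < m) w i * x i)) => //.
apply: pp_add (pp_cst _ _) _; apply: pp_sum => i.
by apply: pp_mul; [exact: pp_cst|exact: pp_coord].
Qed.

Definition pp_pred m (b : env -> bool) := ppoly m (fun x => (b x)%:R).

Lemma pp_predN m b : pp_pred m b -> pp_pred m (fun x => ~~ b x).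
Proof.
move=> pb; apply: (@pp_ext _ (fun x => 1 + (-1) * (b x)%:R)).
  by move=> x; case: (b x); rewrite ?mulr1 ?mulr0 ?subrr ?addr0.
apply: pp_add (pp_cst _ _) _; exact: pp_mul (pp_cst _ _) pb.
Qed.

Lemma pp_pred_all m (T : finType) (b : T -> env -> bool) :
  (forall i, pp_pred m (b i)) -> pp_pred m (fun x => [forall i, b i x]).
Proof.
move=> pb; apply: (@pp_ext _ (fun x => \prod_(i : T) (b i x)%:R)); last exact: pp_prod.
move=> x; case: forallP => [h|/forallP /forallPn[i /negPf bi]].
  by rewrite big1 // => i _; rewrite h.
by rewrite (bigD1 i) //= bi mul0r.
Qed.

Lemma pp_predI m b b' : pp_pred m b -> pp_pred m b' -> pp_pred m (fun x => b x && b' x).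
Proof.
move=> pb pb'; apply: (@pp_ext _ (fun x => (b x)%:R * (b' x)%:R)); last exact: pp_mul.
by move=> x; case: (b x); rewrite ?mul1r ?mul0r.
Qed.

Lemma pp_lteif m u w b : affine m u -> affine m w ->
  pp_pred m (fun x => (u x < w x ?<= if b)%R).
Proof.
case: b => au aw.
  apply: (@pp_ext _ (fun x => (0 <= w x + - u x)%R%:R)) => [x|].
    by rewrite subr_ge0.
  apply: pp_ind; apply: affineD aw _; exact: affineN.
apply: (@pp_ext _ (fun x => (~~ (0 <= u x + - w x)%R)%:R)) => [x|].
  by rewrite subr_ge0 -ltNge.
apply: pp_predN; apply: pp_ind; apply: affineD au _; exact: affineN.
Qed.

Lemma pp_pred_polyhedral m P : polyhedral m P -> pp_pred m (fun x => `[< P x >]).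
Proof.
move=> [T [F [aF PE]]].
apply: (@pp_ext _ (fun x => [forall i, (0 <= F i x)%R]%:R)).
  by move=> x; congr (_%:R); congr nat_of_bool; apply/forallP/asboolP => /PE.
by apply: pp_pred_all => i; exact: pp_ind.
Qed.

Definition in_box m (N : nat) x := forall i, (i < m)%N -> 0 <= x i <= N%:R.

Lemma pp_bounded m N f : ppoly m f ->
  exists2 B, 0 <= B & forall x, in_box m N x -> `|f x| <= B.
Proof.
elim=> {f} [c|i im|f af|f g _ [B B0 IHf] _ [B' B0' IHg]|f g _ [B B0 IHf] _ [B' B0' IHg]
  |f g fg _ [B B0 IH]].
- by exists `|c|.
- by exists N%:R => // x /(_ i im) /andP[x0 xN]; rewrite ger0_norm.
- by exists 1 => // x _; rewrite normr_nat lern1 leq_b1.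
- exists (B + B') => [|x xN]; first exact: addr_ge0.
  by apply: le_trans (ler_normD _ _) _; rewrite lerD ?IHf ?IHg.
- exists (B * B') => [|x xN]; first exact: mulr_ge0.
  by rewrite normrM ler_pM ?IHf ?IHg.
- by exists B => // x xN; rewrite -fg IH.
Qed.

(** A constraint on the last variable: none, or being smaller than an affine
    function of the other ones, non-strictly if the boolean is true.  A lower
    bound enters as the complement of an upper bound. *)
Definition below (thr : option (bool * (env -> rat))) x (t : rat) : bool :=
  if thr is Some (b, u) then (t < u x ?<= if b)%R else true.

Definition affine_thr m (thr : option (bool * (env -> rat))) :=
  if thr is Some (b, u) then affine m u else True.

(** Sums of terms c(x) t^k [t below u(x)] in the last variable t = x m. *)
Inductive nform m : (env -> rat) -> Prop :=
| nf_term c k thr : ppoly m c -> affine_thr m thr ->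
    nform m (fun x => c x * x m ^+ k * (below thr x (x m))%:R)
| nf_add f g : nform m f -> nform m g -> nform m (fun x => f x + g x)
| nf_ext f g : (forall x, f x = g x) -> nform m f -> nform m g.

(** Of two upper bounds only the smaller one counts, and which one it is depends
    only on the other variables. *)
Lemma below_inter m thr1 thr2 : affine_thr m thr1 -> affine_thr m thr2 ->
  exists2 b, pp_pred m b & forall x t,
    below thr1 x t && below thr2 x t = if b x then below thr1 x t else below thr2 x t.
Proof.
case: thr1 thr2 => [[b1 u1]|] [[b2 u2]|] /= a1 a2.
- exists (fun x => (u1 x < u2 x ?<= if b1 ==> b2)%R); first exact: pp_lteif.
  move=> x t; case: b1 b2 {a1 a2} => [] [] /=;
  by case: ifP => h; apply/idP/idP => [/andP[]//|h']; rewrite ?h' ?andbT /=; lra.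
- by exists (fun=> true) => [|x t]; [exact: pp_cst|rewrite andbT].
- by exists (fun=> false) => [|x t]; first exact: pp_cst.
- by exists (fun=> true) => [|x t]; first exact: pp_cst.
Qed.

Lemma nf_mul m f g : nform m f -> nform m g -> nform m (fun x => f x * g x).
Proof.
move=> nf ng; elim: nf => {f} [c k thr pc at_|f f' _ IHf _ IHf'|f f' ff' _ IH].
- elim: ng => {g} [c' k' thr' pc' at'|f f' _ IHf _ IHf'|f f' ff' _ IH].
  + have [b pb bP] := below_inter at_ at'.
    apply: (@nf_ext _ (fun x =>
      (c x * c' x * (b x)%:R) * x m ^+ (k + k') * (below thr x (x m))%:R +
      (c x * c' x * (~~ b x)%:R) * x m ^+ (k + k') * (below thr' x (x m))%:R)).
      move=> x; rewrite exprD.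
      transitivity (c x * c' x * (x m ^+ k * x m ^+ k') *
        (below thr x (x m) && below thr' x (x m))%:R).
        by rewrite bP; case: (b x) => /=; ring.
      by rewrite -mulnb natrM; ring.
    apply: nf_add; apply: nf_term => //; apply: pp_mul => //; try exact: pp_mul.
    exact: pp_predN.
  + apply: nf_ext (nf_add IHf IHf') => x; by rewrite mulrDr.
  + by apply: nf_ext IH => x; rewrite ff'.
- by apply: nf_ext (nf_add IHf IHf') => x; rewrite mulrDl.
- by apply: nf_ext IH => x; rewrite ff'.
Qed.

Lemma nf_coef m c k : ppoly m c -> nform m (fun x => c x * x m ^+ k).
Proof.
move=> pc; apply: (@nf_ext _ (fun x => c x * x m ^+ k * (below None x (x m))%:R)).
  by move=> x; rewrite mulr1.
exact: nf_term.
Qed.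

Lemma halfline_pos (al g t : rat) : 0 < al ->
  (0 <= g + al * t) = (- al^-1 * g <= t).
Proof.
move=> al0; rewrite -[RHS](ler_pM2l al0) mulrA mulrN divff ?gt_eqF //.
by apply/idP/idP; lra.
Qed.

Lemma halfline_neg (al g t : rat) : al < 0 ->
  (0 <= g + al * t) = (t <= - al^-1 * g).
Proof.
move=> al0; rewrite -[RHS](ler_nM2l al0) mulrA mulrN divff ?lt_eqF //.
by apply/idP/idP; lra.
Qed.

Lemma nform_ppoly m f : ppoly m.+1 f -> nform m f.
Proof.
elim=> {f} [c|i im|f af|f g _ IHf _ IHg|f g _ IHf _ IHg|f g fg _ IH].
- by apply: nf_ext (nf_coef 0 (pp_cst m c)) => x; rewrite mulr1.
- move: im; rewrite ltnS leq_eqVlt => /orP[/eqP ->|im].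
    by apply: nf_ext (nf_coef 1 (pp_cst m 1)) => x; rewrite mul1r.
  by apply: nf_ext (nf_coef 0 (pp_coord im)) => x; rewrite mulr1.
- have [g [al [ag fE]]] := affine_split af.
  have au : affine m (fun x => (- al^-1) * g x) by exact: affineZ.
  have [al0|al0|al0] := ltgtP al 0.
  + apply: nf_ext (@nf_term m (fun=> 1) 0 (Some (true, fun x => (- al^-1) * g x))
      (pp_cst _ _) au) => x.
    by rewrite !mul1r /= fE halfline_neg.
  + apply: (@nf_ext _ (fun x => 1 * x m ^+ 0 + (-1) * x m ^+ 0 *
      (below (Some (false, fun x => (- al^-1) * g x)) x (x m))%:R)); last first.
      by apply: nf_add; [exact: nf_coef (pp_cst _ _)|exact: (@nf_term m (fun=> -1) 0
        (Some (false, fun x => (- al^-1) * g x)) (pp_cst _ _) au)].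
    move=> x; rewrite !mulr1 /= fE halfline_pos // ltNge.
    by case: (_ <= _); rewrite /= ?mulr0 ?mulr1 ?addr0 ?subrr.
  + apply: nf_ext (nf_coef 0 (pp_ind ag)) => x.
    by rewrite mulr1 fE al0 mul0r addr0.
- exact: nf_add.
- exact: nf_mul.
- exact: nf_ext IH.
Qed.

End PiecewisePolynomials.

(** * Riemann sums in one variable *)

Section RiemannSums.
Local Notation env := (nat -> rat).
Implicit Types (x y : env) (f g : env -> rat).

Lemma exprS_sub_bounds (a b : rat) k : 0 <= a -> a <= b ->
  k.+1%:R * a ^+ k * (b - a) <= b ^+ k.+1 - a ^+ k.+1 <= k.+1%:R * b ^+ k * (b - a).
Proof.
move=> a0 ab; have b0 := le_trans a0 ab.
have sumc X : k.+1%:R * X = \sum_(i < k.+1) X :> rat.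
  by rewrite sumr_const card_ord mulr_natl.
have ab0 : 0 <= b - a by rewrite subr_ge0.
rewrite subrXX [leLHS]mulrC [_ * b ^+ k * _]mulrC !sumc.
apply/andP; split; apply: ler_wpM2l => //; apply: ler_sum => i _;
  rewrite /=; have ik := ltnSE (ltn_ord i).
  rewrite -{1}(subnK ik) exprD.
  by apply: ler_wpM2r; rewrite ?exprn_ge0 // lerXn2r.
rewrite -[X in _ <= b ^+ X](subnK ik) exprD.
by apply: ler_wpM2l; rewrite ?exprn_ge0 // lerXn2r.
Qed.

Lemma expr_lipschitz (a b N : rat) k : 0 <= a <= N -> 0 <= b <= N ->
  `|a ^+ k.+1 / k.+1%:R - b ^+ k.+1 / k.+1%:R| <= N ^+ k * `|a - b|.
Proof.
wlog ab : a b / a <= b => [hw ha hb|/andP[a0 aN] /andP[b0 bN]].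
  by have [/hw|/ltW /hw] := leP a b; [exact|rewrite distrC [`|a - b|]distrC; exact].
have k0 : (0 : rat) < k.+1%:R by rewrite ltr0n.
rewrite distrC [`|a - b|]distrC -mulrBl normrM.
rewrite ger0_norm ?subr_ge0 ?lerXn2r ?nnegrE // [`|b - a|]ger0_norm ?subr_ge0 //.
rewrite ger0_norm ?invr_ge0 ?ler0n // ler_pdivrMr //.
have /andP[_ h] := exprS_sub_bounds k a0 ab.
apply: le_trans h _; rewrite [leRHS]mulrC mulrA.
apply: ler_wpM2r; first by rewrite subr_ge0.
by apply: ler_wpM2l => //; rewrite lerXn2r // nnegrE (le_trans b0 bN).
Qed.

Lemma power_sum k T :
  0 <= (T%:R : rat) ^+ k.+1 / k.+1%:R - \sum_(t < T) t%:R ^+ k <= T%:R ^+ k.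
Proof.
have k0 : (0 : rat) < k.+1%:R by rewrite ltr0n.
elim: T => [|T /andP[IH0 IH1]].
  by rewrite big_ord0 subr0 expr0n /= mul0r lexx exprn_ge0.
have TS : T%:R <= T.+1%:R :> rat by rewrite ler_nat.
have /andP[] := @exprS_sub_bounds T%:R T.+1%:R k (ler0n _ _) TS.
have -> : T.+1%:R - T%:R = 1 :> rat by rewrite -natr1 addrC addKr.
rewrite !mulr1 big_ord_recr /= => h0 h1.
rewrite mulrC -ler_pdivlMr // mulrBl in h0.
rewrite [leRHS]mulrC -ler_pdivrMr // mulrBl in h1.
move: IH0 IH1 h0 h1; move: (T.+1%:R ^+ k.+1 / _) (T%:R ^+ k.+1 / _) (T.+1%:R ^+ k).
move: (T%:R ^+ k) (\sum_(i < T) _) => a s A B b IH0 IH1 h0 h1.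
by apply/andP; split; lra.
Qed.

Definition clamp (N w : rat) : rat := if w < 0 then 0 else if w <= N then w else N.

Lemma clamp_itv N w : 0 <= N -> 0 <= clamp N w <= N.
Proof.
move=> N0; rewrite /clamp; case: (ltP w 0) => [_|w0]; first by rewrite lexx.
by case: (leP w N) => [wN|_]; rewrite ?w0 ?wN ?N0 ?lexx.
Qed.

(** The integers below w form an initial segment of length [clamp N w] up to an
    error of at most 1, whether w itself is included or not. *)
Lemma threshold (N : nat) b (w : rat) :
  exists T : nat, [/\ (T <= N)%N,
    forall t, (t < N)%N -> (t%:R < w ?<= if b)%R = (t < T)%N &
    `|T%:R - clamp N%:R w| <= 1].
Proof.
elim: N => [|N [T [TN tT Tw]]].
  exists 0%N; split => //; rewrite /clamp; case: (ltP w 0) => w0; rewrite ?subrr ?normr0 //.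
  by case: (leP w 0) => ?; rewrite ler_norml; lra.
have N1 : N.+1%:R = N%:R + 1 :> rat by rewrite natr1.
have N0 : 0 <= N%:R :> rat by rewrite ler0n.
case Nw : (N%:R < w ?<= if b)%R.
  exists N.+1; split => // [t|].
    rewrite ltnS => tN; rewrite tN.
    have : t%:R <= N%:R :> rat by rewrite ler_nat.
    by case: b Nw {tT} => /= Nw h; [exact: le_trans h Nw|exact: le_lt_trans h Nw].
  have Nw' : N%:R <= w by case: b Nw {tT} => //= /ltW.
  move: Nw'; rewrite N1 /clamp; case: (ltP w 0) => ?; first by lra.
  by case: (leP w) => ? ?; rewrite ler_norml; lra.
have wN : w <= N%:R.
  by case: b Nw {tT} => /= /negbT; rewrite -?ltNge -?leNgt // => /ltW.
exists T; split => [|t|]; first by rewrite ltnW.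
  rewrite ltnS leq_eqVlt => /orP[/eqP ->|/tT //].
  by rewrite Nw ltnNge TN.
move: Tw; rewrite /clamp wN.
by rewrite (_ : w <= N.+1%:R) // N1; lra.
Qed.

(** The constant is uniform in the endpoint u, as the integration of functions
    of several variables requires.  One M^k accounts for the power sum
    ([power_sum]), the other for rounding the endpoint to a multiple of 1/n
    ([threshold], [expr_lipschitz]). *)
Lemma riemann_power (M k : nat) : exists2 C : rat, 0 <= C &
  forall (n : nat) b (u : rat), (0 < n)%N ->
  `|(\sum_(t < M * n) (t%:R / n%:R) ^+ k * (t%:R / n%:R < u ?<= if b)%R%:R) / n%:R -
    clamp M%:R u ^+ k.+1 / k.+1%:R| <= C / n%:R.
Proof.
exists (2 * M%:R ^+ k) => [|n b u n0]; first by rewrite mulr_ge0 ?exprn_ge0.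
have n0' : (0 : rat) < n%:R by rewrite ltr0n.
have [T [TN tT Tw]] := threshold (M * n) b (n%:R * u).
have -> : \sum_(t < M * n) (t%:R / n%:R) ^+ k * (t%:R / n%:R < u ?<= if b)%R%:R =
    (\sum_(t < T) t%:R ^+ k) / n%:R ^+ k :> rat.
  transitivity (\sum_(t < M * n | (t < T)%N) (t%:R / n%:R) ^+ k : rat).
    rewrite [RHS]big_mkcond; apply: eq_bigr => t _ /=.
    rewrite -tT //.
    have -> : (t%:R < n%:R * u ?<= if b)%R = (t%:R / n%:R < u ?<= if b)%R.
      by case: b {tT} => /=; rewrite [n%:R * u]mulrC ?ler_pdivrMr ?ltr_pdivrMr.
    by case: (_ < _ ?<= if _)%R; rewrite ?mulr1 ?mulr0.
  rewrite -(big_ord_widen _ (fun t => (t%:R / n%:R) ^+ k : rat) TN) mulr_suml.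
  by apply: eq_bigr => t _; rewrite expr_div_n.
have cl : clamp (M * n)%:R (n%:R * u) = n%:R * clamp M%:R u.
  rewrite /clamp pmulr_rlt0 // natrM [_ * n%:R]mulrC ler_pM2l //.
  by case: ifP => _; [rewrite mulr0|case: ifP].
rewrite cl in Tw.
have -> : (\sum_(t < T) t%:R ^+ k) / n%:R ^+ k / n%:R - clamp M%:R u ^+ k.+1 / k.+1%:R =
  (\sum_(t < T) t%:R ^+ k - (n%:R * clamp M%:R u) ^+ k.+1 / k.+1%:R) / n%:R ^+ k.+1 :> rat.
  rewrite exprMn mulrBl; congr (_ - _); first by rewrite exprSr -mulrA -invfM mulrC.
  by rewrite mulrAC [_ * clamp _ _ ^+ _]mulrC mulfK // expf_neq0 // gt_eqF.
rewrite normrM [`|(_)^-1|]ger0_norm ?invr_ge0 ?exprn_ge0 //.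
rewrite ler_pdivrMr ?exprn_gt0 //.
have -> : 2 * M%:R ^+ k / n%:R * n%:R ^+ k.+1 = 2 * (M * n)%:R ^+ k :> rat.
  by rewrite exprS mulrA divfK ?gt_eqF // natrM exprMn mulrA.
have /andP[s0 s1] := power_sum k T.
have TMn : T%:R <= (M * n)%:R :> rat by rewrite ler_nat.
have Tk : T%:R ^+ k <= (M * n)%:R ^+ k :> rat by rewrite lerXn2r // nnegrE.
have := @expr_lipschitz T%:R (n%:R * clamp M%:R u) (M * n)%:R k.
rewrite ler0n TMn /= => /(_ isT) h.
have {h} : `|T%:R ^+ k.+1 / k.+1%:R - (n%:R * clamp M%:R u) ^+ k.+1 / k.+1%:R|
    <= (M * n)%:R ^+ k :> rat.
  have cM := clamp_itv u (ler0n rat M).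
  apply: le_trans (h _) _.
    have /andP[c0 c1] := cM; rewrite mulr_ge0 // natrM mulrC.
    by apply: ler_wpM2r.
  by rewrite ler_piMr ?exprn_ge0.
move: s0 s1 Tk; rewrite !ler_norml.
move: (\sum_(t < T) _) (T%:R ^+ k.+1 / k.+1%:R) => A B.
move: ((n%:R * clamp M%:R u) ^+ k.+1 / k.+1%:R) (T%:R ^+ k) ((M * n)%:R ^+ k) => C D G.
by move=> *; lra.
Qed.

End RiemannSums.

(** * Sums over the lattice points of a box *)

Section BoxSums.
Local Notation env := (nat -> rat).
Implicit Types (x y : env) (f g : env -> rat).

Definition line_mean (M n m : nat) f x : rat :=
  (\sum_(t < M * n) f (upd x m (t%:R / n%:R))) / n%:R.

Lemma pp_clamp m (N : rat) u : affine m u -> ppoly m (fun x => clamp N (u x)).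
Proof.
move=> au.
have p0 : pp_pred m (fun x => ~~ (u x < 0)).
  exact: (pp_predN (pp_lteif false au (affine_cst m 0))).
have pN := pp_lteif true au (affine_cst m N).
apply: (@pp_ext _ (fun x => (~~ (u x < 0)%R)%:R *
   ((u x <= N)%R%:R * u x + (~~ (u x <= N)%R)%:R * N))).
  move=> x; rewrite /clamp; case: ifP => _; first by rewrite mul0r.
  by case: ifP => _; rewrite !mul1r mul0r ?addr0 ?add0r.
apply: pp_mul => //; apply: pp_add; apply: pp_mul.
- exact: pN. - exact: pp_affine. - exact: pp_predN pN. - exact: pp_cst.
Qed.

(** Integration over the last variable: a term c(x) t^k [t < u(x)] has the
    integral c(x) v^(k+1) / (k+1), where v is u(x) cut off to the interval
    [0, M]. *)
Lemma nform_mean M m f : nform m f -> exists2 G, ppoly m G &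
  exists2 C : rat, 0 <= C & forall n x, (0 < n)%N -> in_box m M x ->
    `|line_mean M n m f x - G x| <= C / n%:R.
Proof.
elim=> {f} [c k thr pc athr|f g _ [G pG [C C0 GC]] _ [G' pG' [C' C'0 GC']]
  |f g fg _ [G pG [C C0 GC]]].
- have [C C0 CP] := riemann_power M k.
  have [B B0 BP] := pp_bounded M pc.
  pose u x := if thr is Some (b, u) then u x else M%:R.
  pose b := if thr is Some (b, u) then b else false.
  have au : affine m u by move: athr; rewrite /u; case: (thr) => [[? ?]|_] //; exact: affine_cst.
  exists (fun x => c x * (clamp M%:R (u x) ^+ k.+1 * k.+1%:R^-1)).
    apply: pp_mul pc _; apply: pp_mul (pp_cst _ _); apply: pp_exp; exact: pp_clamp.
  exists (B * C) => [|n x n0 xM]; first exact: mulr_ge0.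
  have updx t i : (i < m)%N -> upd x m t i = x i by move=> im; rewrite /upd ltn_eqF.
  have n0' : (0 : rat) < n%:R by rewrite ltr0n.
  rewrite /line_mean [X in X / _](_ : _ = c x * \sum_(t < M * n)
      (t%:R / n%:R) ^+ k * (t%:R / n%:R < u x ?<= if b)%R%:R).
    rewrite -mulrA -mulrBr normrM -mulrA; apply: ler_pM => //; first exact: BP.
    exact: CP.
  rewrite mulr_sumr; apply: eq_bigr => t _.
  rewrite (pp_dep pc (updx _)) /upd eqxx -mulrA; congr (_ * (_ * _%:R)).
  move: athr; rewrite /u /b /below; case: (thr) => [[b' u'] au'|_].
    by rewrite (affine_dep au' (updx _)).
  by rewrite /= ltr_pdivrMr // -natrM ltr_nat ltn_ord.
- exists (fun x => G x + G' x); first exact: pp_add.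
  exists (C + C') => [|n x n0 xM]; first exact: addr_ge0.
  rewrite /line_mean big_split mulrDl opprD addrACA mulrDl.
  by apply: le_trans (ler_normD _ _) _; apply: lerD; [exact: GC|exact: GC'].
- exists G => //; exists C => // n x n0 xM.
  by rewrite /line_mean; under eq_bigr do rewrite -fg; exact: GC.
Qed.

Definition box_point (m N n : nat) (t : {ffun 'I_m -> 'I_N}) : env :=
  fun i => if insub i is Some j then (t j)%:R / n%:R else 0.

Definition box_sum (m M n : nat) f : rat :=
  \sum_(t : {ffun 'I_m -> 'I_(M * n)}) f (box_point n t).

Lemma box_pointE m N n (t : {ffun 'I_m -> 'I_N}) (j : 'I_m) :
  box_point n t j = (t j)%:R / n%:R.
Proof. by rewrite /box_point valK. Qed.

Lemma box_sumS m M n f : ppoly m.+1 f -> (0 < n)%N ->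
  box_sum m.+1 M n f / n%:R ^+ m.+1 = box_sum m M n (line_mean M n m f) / n%:R ^+ m.
Proof.
move=> pf n0; rewrite /box_sum /line_mean.
pose ext (p : {ffun 'I_m -> 'I_(M * n)} * 'I_(M * n)) : {ffun 'I_m.+1 -> 'I_(M * n)} :=
  [ffun i => if unlift ord_max i is Some j then p.1 j else p.2].
pose res (t : {ffun 'I_m.+1 -> 'I_(M * n)}) :=
  ([ffun j : 'I_m => t (lift ord_max j)], t ord_max).
have extK : cancel ext res.
  move=> [p s]; rewrite /res /ext ffunE unlift_none /=; congr (_, _).
  by apply/ffunP => j; rewrite !ffunE liftK.
have resK : cancel res ext.
  by move=> t; apply/ffunP => i; rewrite ffunE; case: unliftP => [j|] -> //=; rewrite ffunE.
rewrite (reindex ext) /=; last by apply: onW_bij; exists res.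
rewrite -mulr_suml.
rewrite (pair_big xpredT xpredT
  (fun p s => f (upd (box_point n p) m ((s : 'I__)%:R / n%:R)))) /=.
rewrite exprS invfM mulrA; congr (_ / _ / _); apply: eq_bigr => -[p s] _ /=.
apply: (pp_dep pf) => i; rewrite ltnS leq_eqVlt => /orP[/eqP ->|im].
  rewrite /upd eqxx -[m in LHS]/(val (ord_max : 'I_m.+1)) box_pointE ffunE.
  by rewrite unlift_none.
have -> : i = lift ord_max (Ordinal im) by rewrite /= /bump leqNgt im.
rewrite box_pointE ffunE liftK /upd lift_max /= ltn_eqF //.
by rewrite -[i in RHS]/(val (Ordinal im)) box_pointE.
Qed.

(** The last variable is integrated out at the cost of O(1/n) in each of the
    (M n)^m terms of the remaining sum, which is O(1/n) after division by
    n^m. *)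
Theorem box_sum_limit m M f : ppoly m f -> exists (q C : rat), 0 <= C /\
  forall n, (0 < n)%N -> `|box_sum m M n f / n%:R ^+ m - q| <= C / n%:R.
Proof.
elim: m f => [|m IH] f pf.
  exists (f (fun=> 0)), 0; split=> // n n0.
  rewrite /box_sum expr0 divr1 (big_pred1 [ffun i : 'I_0 => ltac:(by case: i)]).
    rewrite (pp_dep pf (y := fun=> 0)) //.
    by rewrite subrr normr0 mul0r.
  by move=> t; apply/esym/eqP/ffunP => -[].
have [G pG [C C0 GC]] := nform_mean M (nform_ppoly pf).
have [q [C' [C'0 qC]]] := IH G pG.
exists q, (M%:R ^+ m * C + C'); split; first by rewrite addr_ge0 ?mulr_ge0 ?exprn_ge0.
move=> n n0; rewrite box_sumS //.
have n0' : (0 : rat) < n%:R by rewrite ltr0n.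
set X := box_sum m M n _.
have -> : X / n%:R ^+ m - q = (X - box_sum m M n G) / n%:R ^+ m + (box_sum m M n G / n%:R ^+ m - q).
  by rewrite mulrBl addrA subrK.
rewrite [leRHS]mulrDl; apply: le_trans (ler_normD _ _) _; apply: lerD; last exact: qC.
rewrite normrM [`|_^-1|]ger0_norm ?invr_ge0 ?exprn_ge0 // ler_pdivrMr ?exprn_gt0 //.
rewrite /X /box_sum -sumrB; apply: le_trans (ler_norm_sum _ _ _) _.
apply: (@le_trans _ _ (\sum_(t : {ffun 'I_m -> 'I_(M * n)}) C / n%:R)).
  apply: ler_sum => t _; apply: GC => // i im.
  rewrite -[i]/(val (Ordinal im)) box_pointE divr_ge0 //= ler_pdivrMr // -natrM.
  by rewrite ler_nat ltnW.
rewrite sumr_const card_ffun !card_ord -[_ *+ (_ ^ _)]mulr_natl natrX natrM exprMn.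
by rewrite le_eqVlt; apply/orP; left; apply/eqP; ring.
Qed.

End BoxSums.

(** * The family of a point is piecewise constant *)

Section NewtonFamilies.
Variables (d r : nat) (v : 'I_r -> multinom d).
Local Notation env := (nat -> rat).
Implicit Types (x y : env) (S : {set 'I_d}).

(** The coefficients of the convex combination are put in the coordinates
    d, ..., d + r - 1 and then eliminated. *)
Lemma newton_polyhedral S : polyhedral d (newton v S).
Proof.
pose wsum l (y : env) := \sum_(i < r) y (d + i)%N * (v i l)%:R.
pose total (y : env) := \sum_(i < r) y (d + i)%N.
pose F (z : 'I_r + bool + 'I_d) : env -> rat := match z with
  | inl (inl i) => fun y => y (d + i)%N
  | inl (inr true) => fun y => total y + - 1
  | inl (inr false) => fun y => 1 + - total y
  | inr l => if l \in S then fun=> 0 else fun y => y l + - wsum l y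
  end.
pose P y := forall z, 0 <= F z y.
have coord (i : 'I_r) : affine (d + r) (fun y => y (d + i)%N).
  by apply: affine_coord; rewrite ltn_add2l.
have atotal : affine (d + r) total by apply: affine_sum => i; exact: coord.
have awsum l : affine (d + r) (wsum l).
  apply: affine_sum => i; have [c [w h]] := affineZ (v i l)%:R (coord i).
  by exists c, w => x; rewrite -h mulrC.
have pP : polyhedral (d + r) P.
  exists ('I_r + bool + 'I_d)%type, F; split => // -[[i|[]]|l] /=.
  - exact: coord.
  - exact: affineD atotal (affine_cst _ _).
  - exact: affineD (affine_cst _ _) (affineN atotal).
  - case: ifP => _; first exact: affine_cst.
    by apply: affineD (affineN (awsum l)); apply: affine_coord; rewrite ltn_addr.
have [T [G [aG GP]]] := polyhedral_project pP.
exists T, G; split => // x; rewrite -GP; split.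
  move=> [lam [lam0 lam1 laml]].
  pose y i := if (i < d)%N then x i else if insub (i - d)%N is Some j then lam j else 0.
  have yx i : (i < d)%N -> y i = x i by rewrite /y => ->.
  have yl (i : 'I_r) : y (d + i)%N = lam i.
    by rewrite /y ltnNge leq_addr /= addKn valK.
  exists y => // -[[i|[]]|l] /=.
  - by rewrite yl.
  - by rewrite /total (eq_bigr lam) // lam1 subrr.
  - by rewrite /total (eq_bigr lam) // lam1 subrr.
  - case: ifPn => // lS; rewrite subr_ge0 yx // /wsum.
    by under eq_bigr do rewrite yl; exact: laml.
move=> [y yx Py]; exists (fun i => y (d + i)%N); split.
- by move=> i; exact: (Py (inl (inl i))).
- apply/eqP; rewrite eq_le -subr_ge0 (Py (inl (inr false))) /=.
  by rewrite -subr_ge0 (Py (inl (inr true))).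
- move=> l lS; rewrite -yx // -subr_ge0.
  by have := Py (inr l); rewrite /= (negPf lS).
Qed.

(** The point x lies on the piece of a family F when its membership in each of
    finitely many polyhedra is the one prescribed by F. *)
Lemma newton_family_pp (h : {set {set 'I_d}} -> nat) :
  ppoly d (fun x => (h (newton_family v x))%:R).
Proof.
pose mem_fam (S : {set 'I_d}) x := S \in newton_family v x.
have pmem S : pp_pred d (mem_fam S).
  apply: (@pp_ext _ (fun x => (~~ `[< newton v S x >] &&
      [forall l : 'I_d, (l \in S) || (0 <= x l)%R])%:R)).
    move=> x; rewrite /mem_fam finset.inE; congr (_%:R); congr nat_of_bool.
    congr (_ && _); apply: eq_forallb => l; by rewrite implybE negbK.
  apply: pp_predI.
    apply: pp_predN; exact: (pp_pred_polyhedral (newton_polyhedral S)).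
  apply: pp_pred_all => l; case: (l \in S); first exact: pp_cst.
  exact: pp_ind (affine_coord _).
apply: (@pp_ext _ (fun x => \sum_(F : {set {set 'I_d}})
    (h F)%:R * ([forall S, mem_fam S x == (S \in F)])%:R)).
  move=> x; rewrite (bigD1 (newton_family v x)) //= big1 ?addr0 => [|F].
    rewrite (_ : [forall _, _] = true) ?mulr1 //.
    by apply/forallP => S; rewrite /mem_fam eqxx.
  move=> Fx; rewrite (_ : [forall _, _] = false) ?mulr0 //.
  apply/negP => /forallP e; case/eqP: Fx; apply/setP => S.
  by have /eqP <- := e S.
apply: pp_sum => F; apply: pp_mul; first exact: pp_cst.
apply: pp_pred_all => S; case: (S \in F).
  by apply: pp_ext (pmem S) => x; case: (mem_fam S x).
by apply: pp_ext (pp_predN (pmem S)) => x; case: (mem_fam S x).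
Qed.

(** A negative coordinate forces its index to be in S, where the polyhedron does
    not constrain it; a coordinate beyond all exponents of the generators
    satisfies its constraint automatically. *)
Lemma newton_family_sub x y S :
  (forall l : 'I_d, [\/ x l = y l,
     (exponent_bound v)%:R <= x l /\ (exponent_bound v)%:R <= y l | x l < 0 /\ y l < 0]) ->
  S \in newton_family v x -> S \in newton_family v y.
Proof.
move=> xy; rewrite !finset.inE => /andP[/asboolPn nS /forallP xS].
have B0 : (0 : rat) <= (exponent_bound v)%:R by rewrite ler0n.
apply/andP; split; last first.
  apply/forallP => l; apply/implyP => lS; have := implyP (xS l) lS.
  by case: (xy l) => [->|[_ /(le_trans B0)]|[+ _]] //; rewrite ltNge => /negPf ->.
apply/asboolPn => -[lam [lam0 lam1 laml]]; apply: nS; exists lam; split => // l lS.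
case: (xy l) => [->|[xB _]|[xl _]]; first exact: laml.
  by apply: le_trans xB; exact: weighted_exponent_le.
by have := implyP (xS l) lS; rewrite leNgt xl.
Qed.

Lemma newton_family_eq x y :
  (forall l : 'I_d, [\/ x l = y l,
     (exponent_bound v)%:R <= x l /\ (exponent_bound v)%:R <= y l | x l < 0 /\ y l < 0]) ->
  newton_family v x = newton_family v y.
Proof.
move=> xy; apply/setP => S; apply/idP/idP; apply: newton_family_sub => //.
by move=> l; case: (xy l) => [->|[]|[]]; [constructor 1|constructor 2|constructor 3].
Qed.

End NewtonFamilies.

(** * Exceptional degrees are few *)

Section ExceptionalCount.
Variables (k : fieldType) (d r : nat) (v : 'I_r -> multinom d).
Variable (I : ideal (mpoly d k)).
Hypothesis Iv : has_exponents I (gens_exps v).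
Hypothesis Inormal : locally_normal I.
Local Notation deg := {ffun 'I_d -> int}.

(** A box of side [side * n] contains all exceptional degrees ([exceptional_lt])
    and all points a with a/n in the support of the Betti numbers. *)
Definition side : nat := exponent_bound v + absorption v.

Definition box_deg N (t : {ffun 'I_d -> 'I_N}) : deg := [ffun j => (t j : nat)%:Z].

Lemma box_deg_inj N : injective (@box_deg N).
Proof.
move=> t u /ffunP tu; apply/ffunP => j; apply/val_inj.
by have := tu j; rewrite !ffunE => -[].
Qed.

Lemma box_point_scaled n N (t : {ffun 'I_d -> 'I_N}) :
  box_point n t = scaled n (box_deg t).
Proof.
apply: funext => i; rewrite /box_point /scaled.
by case: insubP => // j _ _; rewrite ffunE.
Qed.

Lemma box_degP N (a : deg) : (forall j : 'I_d, 0 <= a j < N%:Z) ->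
  exists t : {ffun 'I_d -> 'I_N}, box_deg t = a.
Proof.
move=> aN.
have lt j : (`|a j| < N)%N.
  by have := aN j; move: (a j) => x; lia.
exists [ffun j => Ordinal (lt j)]; apply: degP => j; rewrite !ffunE /=.
by rewrite gez0_abs //; have /andP[] := aN j.
Qed.

Lemma exceptional_lt n (a : deg) (j : 'I_d) : (0 < n)%N ->
  exceptional v n a -> a j < (side * n)%:Z.
Proof.
move=> n0 /(exceptional_bound Iv Inormal j n0) h; apply: lt_le_trans h _.
by rewrite lez_nat /side mulnDl mulnC leq_add2l leq_pmulr.
Qed.

Lemma exceptional_dim0 n (a : deg) : d = 0%N -> ~ exceptional v n a.
Proof.
move=> d0 [_ [lam [_ lam1 _]] []].
have l0 (l : 'I_d) : False by case: l => l; rewrite d0.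
case: r v lam lam1 => [|r'] v' lam; first by rewrite big_ord0 => /eqP; rewrite eq_sym oner_eq0.
move=> _; exists [ffun i => if i == ord0 then n else 0%N] => [|l].
  by under eq_bigr do rewrite ffunE; rewrite -big_mkcond big_pred1_eq.
by case: (l0 l).
Qed.

Definition exceptional_points n : {set {ffun 'I_d -> 'I_(side * n)}} :=
  [set t : {ffun 'I_d -> 'I_(side * n)} | `[< exceptional v n (box_deg t) >]]%SET.

(** An exceptional degree is determined by its coordinates other than the first
    and by the residue of the first one modulo a constant, because two
    exceptional degrees on a line parallel to the first axis are close
    ([exceptional_line]). *)
Lemma exceptional_count : exists2 C : rat, 0 <= C &
  forall n, (0 < n)%N -> #|exceptional_points n|%:R / n%:R ^+ d <= C / n%:R.
Proof.
have [d0|dpos] := posnP d.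
  exists 0 => // n n0; rewrite mul0r [X in X%:R](_ : _ = 0%N) ?mul0r //.
  by apply: eq_card0 => t; rewrite finset.inE; apply/asboolP/exceptional_dim0.
pose j0 : 'I_d := Ordinal dpos.
exists ((absorption v).+1 * side ^ d.-1)%:R => [|n n0]; first by rewrite ler0n.
have n0' : (0 : rat) < n%:R by rewrite ltr0n.
pose proj (t : {ffun 'I_d -> 'I_(side * n)}) :=
  (inord (t j0 %% (absorption v).+1) : 'I_(absorption v).+1,
   [ffun i : 'I_d.-1 => t (lift j0 i)]).
have inj : {in exceptional_points n &, injective proj}.
  move=> t u; rewrite !finset.inE => /asboolP te /asboolP ue [E /ffunP off].
  have off' (l : 'I_d) : l != j0 -> t l = u l.
    by rewrite eq_sym => /unlift_some[i -> _]; have := off i; rewrite !ffunE.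
  have E' : (t j0 = u j0 %[mod (absorption v).+1])%N.
    by have := congr1 val E; rewrite /= !inordK ?ltn_pmod.
  apply/ffunP => l; have [->|/off' //] := eqVneq l j0; apply/val_inj => /=.
  have offz (x y : {ffun 'I_d -> 'I_(side * n)}) : (forall l, l != j0 -> x l = y l) ->
      forall l, l != j0 -> box_deg x l = box_deg y l.
    by move=> xy l' /xy E0; rewrite !ffunE E0.
  have := exceptional_line Iv Inormal n0 te ue (offz t u off').
  have := exceptional_line Iv Inormal n0 ue te (offz u t (fun l lj => esym (off' l lj))).
  rewrite !ffunE -!PoszD !ltz_nat; move: (t j0 : nat) (u j0 : nat) E' => x y.
  move: (absorption v) => K E' xy yx; apply/eqP; rewrite eqn_leq; apply/andP; split.
    rewrite leqNgt; apply/negP => yx'; move: E' => /eqP; rewrite eqn_mod_dvd ?(ltnW yx') //.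
    move=> /dvdn_leq; rewrite subn_gt0 => /(_ yx'); lia.
  rewrite leqNgt; apply/negP => xy'; move: E' => /eqP; rewrite eq_sym eqn_mod_dvd ?(ltnW xy') //.
  move=> /dvdn_leq; rewrite subn_gt0 => /(_ xy'); lia.
have card : (#|exceptional_points n| <= (absorption v).+1 * (side * n) ^ d.-1)%N.
  rewrite -(card_in_imset inj); apply: leq_trans (max_card _) _.
  by rewrite card_prod card_ffun !card_ord.
rewrite ler_pdivrMr ?exprn_gt0 //.
have -> : ((absorption v).+1 * side ^ d.-1)%:R / n%:R * n%:R ^+ d =
    ((absorption v).+1 * (side * n) ^ d.-1)%:R :> rat.
  have -> : n%:R ^+ d = n%:R * n%:R ^+ d.-1 :> rat by rewrite -exprS prednK.
  by rewrite mulrA divfK ?gt_eqF // -natrX -natrM -mulnA -expnMn.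
by rewrite ler_nat.
Qed.

End ExceptionalCount.

(** * The limit *)

Section Assembly.
Variables (K : realType) (k : fieldType) (d r : nat) (v : 'I_r -> multinom d).
Variables (I : ideal (mpoly d k)) (p : nat).
Hypothesis Iv : has_exponents I (gens_exps v).
Hypothesis Inormal : locally_normal I.
Local Notation deg := {ffun 'I_d -> int}.

Definition newton_betti (x : nat -> rat) : nat := betti k (newton_family v x) p.
Definition power_betti n (a : deg) : nat :=
  betti k (degree_family (pow_exps (gens_exps v) n) a) p.

Lemma power_bettiE n a : (0 < n)%N -> ~ exceptional v n a ->
  power_betti n a = newton_betti (scaled n a).
Proof. by move=> n0 na; rewrite /power_betti (degree_familyE Iv Inormal). Qed.

Lemma lc_length_ge n (s : seq deg) : uniq s ->
  ((\sum_(a <- s) power_betti n a)%:R%:E <= lc_length K I p n)%E.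
Proof.
move=> us; apply: length_ge_betti us; last exact: (ideal_exp_exps n Iv).
exact: pow_exps_up.
Qed.

Lemma not_unbounded (X : \bar K) : (forall l : nat, (l%:R%:E <= X)%E) -> ~ (X < +oo)%E.
Proof.
case: X => [x| |] // h _; last by have := h 0%N.
have /= := h (Num.truncn `|x|).+1; rewrite lee_fin leNgt.
by rewrite (le_lt_trans (ler_norm x)) // truncnS_gt.
Qed.

Lemma int_denominator (x : nat -> rat) : exists2 q, (0 < q)%N &
  exists a : deg, forall l : 'I_d, (a l)%:~R = x l * q%:R.
Proof.
have [q [c [q0 qc]]] := common_denominator (fun l : 'I_d => normr_ge0 (x l)).
exists q => //; exists [ffun l : 'I_d => if 0 <= x l then (c l)%:Z else - (c l)%:Z] => l.
rewrite ffunE; case: (leP 0 (x l)) => xl; rewrite ?rmorphN /= -[(_%:Z)%:~R]/((c l)%:R) -qc.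
  by rewrite ger0_norm.
by rewrite ltr0_norm // mulNr opprK.
Qed.

(** Suppose that the coordinate x l is negative or at least [exponent_bound v].
    With q a common denominator of x and n a large multiple of q, the lattice
    point n x can be moved arbitrarily far along the axis of index l, away from
    the box, without changing its family.  Beyond the exceptional degrees this
    yields infinitely many degrees with nonzero cohomology. *)
Lemma newton_betti_support (x : nat -> rat) :
  (\forall n \near \oo, (lc_length K I p n < +oo)%E) -> newton_betti x != 0%N ->
  forall l : 'I_d, 0 <= x l < (exponent_bound v)%:R.
Proof.
move=> [n0 _ fin] bx l; rewrite leNgt [X in _ && X]ltNge -negb_or; apply/negP => xl.
have [q q0 [a0 a0E]] := int_denominator x.
pose n := (q * n0.+1)%N.
have n_gt0 : (0 < n)%N by rewrite muln_gt0 q0.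
have n_gt0' : (0 : rat) < n%:R by rewrite ltr0n.
(* The direction along the axis of index l; the shift by at least
   n * exponent_bound v + absorption v avoids the exceptional degrees. *)
pose sg : int := if x l < 0 then -1 else 1.
pose a (s : nat) : deg := [ffun j => a0 j *+ n0.+1 +
   if j == l then sg * (n * exponent_bound v + absorption v + s)%:Z else 0].
have key (z : rat) : (z * q%:R) *+ n0.+1 / n%:R = z.
  by rewrite -[_ *+ n0.+1]mulr_natr -(mulrA z) -natrM -/n mulfK ?gt_eqF.
have aj s (j : 'I_d) : j != l -> scaled n (a s) j = x j.
  by move=> jl; rewrite scaledE ffunE (negPf jl) addr0 rmorphMn /= a0E key.
have al s : scaled n (a s) l = x l + sg%:~R * (n * exponent_bound v + absorption v + s)%:R / n%:R.
  by rewrite scaledE ffunE eqxx rmorphD rmorphMn rmorphM /= a0E mulrDl key.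
have same s : newton_family v (scaled n (a s)) = newton_family v x.
  apply: newton_family_eq => j; have [->|jl] := eqVneq j l; last first.
    by constructor 1; rewrite aj.
  have h : 0 <= (n * exponent_bound v + absorption v + s)%:R / n%:R :> rat.
    by rewrite divr_ge0.
  rewrite al /sg; case: (ltP (x l) 0) xl => /= [x0 _|x0 xl].
    by constructor 3; split => //; rewrite mulN1r mulNr; lra.
  by constructor 2; split => //; rewrite mul1r; lra.
have nonexc s : ~ exceptional v n (a s).
  move=> ex; have [/forallP/(_ l) al0 _ _] := ex.
  have := exceptional_bound Iv Inormal l n_gt0 ex.
  have : 0 <= scaled n (a s) l by rewrite scaledE divr_ge0 // ler0z.
  rewrite -(ltr_int rat) -[X in X < _](divfK (lt0r_neq0 n_gt0')) -scaledE al.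
  rewrite -[((_ + _)%N%:Z)%:~R]/((_ + _)%N%:R) /sg => h0.
  case: (ltP (x l) 0) xl h0 => /= [x0 _|x0 xl _].
    rewrite mulN1r mulNr => h0; exfalso; move: h0; apply/negP; rewrite -ltNge.
    have : 0 <= (n * exponent_bound v + absorption v + s)%:R / n%:R :> rat by rewrite divr_ge0.
    lra.
  rewrite mul1r mulrDl divfK ?gt_eqF // => h1.
  have : 0 <= x l * n%:R by rewrite mulr_ge0.
  by move: h1; rewrite [in X in X < _]natrD; have := ler0n rat s; lra.
have bs s : power_betti n (a s) != 0%N.
  by rewrite power_bettiE // /newton_betti same.
have ainj : injective a.
  move=> s t /ffunP/(_ l); rewrite !ffunE eqxx => /addrI.
  have sg0 : sg != 0 by rewrite /sg; case: ifP.
  by move=> /(mulfI sg0) [] /addnI.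
apply: (@not_unbounded (lc_length K I p n)) => [m|].
  have := @lc_length_ge n [seq a s | s <- iota 0 m]; rewrite map_inj_uniq // iota_uniq.
  move=> /(_ isT); apply: le_trans; rewrite lee_fin ler_nat big_map.
  apply: (@leq_trans (\sum_(s <- iota 0 m) 1)%N).
    by rewrite sum1_size size_iota.
  by apply: leq_sum => s _; rewrite lt0n.
apply: fin => /=; rewrite /n; apply: leq_trans (leq_pmull _ q0); exact: leqnSn.
Qed.

Definition box_length n : nat :=
  \sum_(t : {ffun 'I_d -> 'I_(side v * n)}) power_betti n (box_deg t).

(** A degree outside the box is not exceptional, and its family is that of a
    point outside the support of the Betti numbers. *)
Lemma lc_lengthE : (\forall n \near \oo, (lc_length K I p n < +oo)%E) ->
  forall n, (0 < n)%N -> lc_length K I p n = (box_length n)%:R%:E.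
Proof.
move=> fin n n0; apply/eqP; rewrite eq_le; apply/andP; split.
  apply: length_le_betti; [exact: pow_exps_up|exact: (ideal_exp_exps n Iv)|].
  move=> b b0; apply: box_degP => j.
  have [eb|neb] := pselect (exceptional v n b).
    have [/forallP b1 _ _] := eb.
    by rewrite b1 (exceptional_lt Iv Inormal).
  move: b0; rewrite -[degree_betti _ _ _ _]/(power_betti n b) power_bettiE //.
  move=> /(newton_betti_support fin)/(_ j); rewrite scaledE.
  rewrite pmulr_lge0 ?invr_gt0 ?ltr0n // ler0z ltr_pdivrMr ?ltr0n // => /andP[-> h].
  rewrite -(ltr_int rat) /=; apply: lt_le_trans h _.
  by rewrite -natrM -[leRHS]/((side v * n)%:R) ler_nat leq_mul2r leq_addr orbT.
have := @lc_length_ge n [seq box_deg t | t : {ffun 'I_d -> 'I_(side v * n)}].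
rewrite map_inj_uniq ?enum_uniq; last exact: box_deg_inj.
by move=> /(_ isT); rewrite big_map big_enum.
Qed.

Lemma box_length_limit : exists (q C : rat), 0 <= C /\
  forall n, (0 < n)%N -> `|(box_length n)%:R / n%:R ^+ d - q| <= C / n%:R.
Proof.
have [q [C [C0 qC]]] := box_sum_limit (side v)
  (newton_family_pp v (fun F => betti k F p)).
have [C' C'0 cC] := exceptional_count Iv Inormal.
pose nmax : rat := #|subset_of_size d p|%:R.
exists q, (nmax * C' + C); split; first by rewrite addr_ge0 // mulr_ge0.
move=> n n0; have n0' : (0 : rat) < n%:R by rewrite ltr0n.
set G := fun x : nat -> rat => (betti k (newton_family v x) p)%:R in qC.
have -> : (box_length n)%:R / n%:R ^+ d - q =
    ((box_length n)%:R - box_sum d (side v) n G) / n%:R ^+ d +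
    (box_sum d (side v) n G / n%:R ^+ d - q) by rewrite mulrBl addrA subrK.
rewrite [leRHS]mulrDl; apply: le_trans (ler_normD _ _) _; apply: lerD; last exact: qC.
rewrite normrM [`|_^-1|]ger0_norm ?invr_ge0 ?exprn_ge0 //.
apply: (@le_trans _ _ (nmax * #|exceptional_points v n|%:R / n%:R ^+ d)); last first.
  by rewrite -!mulrA; apply: ler_wpM2l => //; exact: cC.
apply: ler_wpM2r; first by rewrite invr_ge0 exprn_ge0.
rewrite /box_length natr_sum /box_sum -sumrB; apply: le_trans (ler_norm_sum _ _ _) _.
rewrite mulr_natr -sumr_const [leRHS]big_mkcond /=; apply: ler_sum => t _.
rewrite finset.inE box_point_scaled; case: asboolP => [_|nex]; last first.
  by rewrite power_bettiE // subrr normr0.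
have h1 : (power_betti n (box_deg t))%:R <= nmax by rewrite ler_nat betti_le.
have h2 : G (scaled n (box_deg t)) <= nmax by rewrite ler_nat betti_le.
have h3 : 0 <= G (scaled n (box_deg t)) by rewrite ler0n.
have h4 : 0 <= (power_betti n (box_deg t))%:R :> rat by rewrite ler0n.
by rewrite ler_norml; apply/andP; split; lra.
Qed.

End Assembly.

Theorem corollary4p5 (K : realType) (k : fieldType) (d : nat)
    (I : ideal (mpoly d k)) (i : nat) :
  monomial_ideal I -> locally_normal I ->
  (\forall n \near \oo, (lc_length K I i n < +oo)%E) ->
  exists q : rat,
    (fun n : nat => (lc_length K I i n * ((n%:R ^+ d)^-1)%:E)%E) @ \oo
      --> (ratr q : K)%:E.
Proof.
move=> monI nI fin.
have [r [v Iv]] := monomial_ideal_gens monI.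
have [q [C [C0 qC]]] := box_length_limit i Iv nI.
exists q.
pose f n : K := (box_length k v i n)%:R / n%:R ^+ d.
have fq : f @ \oo --> (ratr q : K).
  apply/cvgrPdist_le => e e0.
  near=> n.
  have n0 : (0 < n)%N by near: n; exact: nbhs_infty_gt.
  have n0' : (0 : K) < n%:R by rewrite ltr0n.
  have -> : ratr q - f n = ratr (q - (box_length k v i n)%:R / n%:R ^+ d).
    by rewrite rmorphB /= fmorph_div rmorphXn /= !ratr_nat.
  rewrite -ratr_norm distrC.
  apply: (@le_trans _ _ (ratr (C / n%:R))); first by rewrite ler_rat qC.
  rewrite fmorph_div /= ratr_nat ler_pdivrMr // mulrC -ler_pdivrMr //.
  near: n; exact: nbhs_infty_ger.
have : (EFin \o f) @ \oo --> (ratr q : K)%:E by by apply: cvg_EFin; [near=> n|exact: fq].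
apply: cvg_trans; apply: near_eq_cvg; near=> n => /=.
have n0 : (0 < n)%N by near: n; exact: nbhs_infty_gt.
by rewrite (lc_lengthE Iv nI fin n0).
Unshelve. all: by end_near.
Qed.
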